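(* For every $d\in[0,1]$, the set of irrational $\theta\in(0,1)$ for which $\dim_H(H_{\theta})=d$ is dense in $(0,1)$.
   Context: Let $S^1=\mathbb{R}/\mathbb{Z}$ be the unit circle, identified with $[0,1)$ with addition modulo one. For irrational $\theta$ define $f(x)=\chi_{[0,1/2]}(x)-\chi_{(1/2,1)}(x)$ ($x\in[0,1)$), $T(x)=x+\theta \bmod 1$, and $S_n(x)=\sum_{i=0}^{n-1} f(T^i(x))$. The heavy set is $H_{\theta}=\{x\in[0,1): S_n(x)\ge 0 \text{ for all } n=1,2,\ldots\}$. $\dim_H$ denotes Hausdorff dimension. *)

(* Defs.v *)
From HB Require Import structures.
From mathcomp Require Import all_boot all_order all_algebra.
From mathcomp Require Import all_classical all_reals all_analysis.

Set Implicit Arguments.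
Unset Strict Implicit.
Unset Printing Implicit Defensive.

Import Order.TTheory GRing.Theory Num.Theory.
Import numFieldNormedType.Exports.

Local Open Scope classical_set_scope.
Local Open Scope ring_scope.

(* For U = set0 this is -oo; the empty set is treated apart in [gauge]. *)
Definition diam (R : realType) (X : metricType R) (U : set X) : \bar R :=
  ereal_sup [set (mdist p.1 p.2)%:E | p in U `*` U].

(* The empty set weighs 0 for every s, while a one-point set weighs 0 for
   s > 0 and 1 for s = 0, so that s = 0 gives the counting measure. *)
Definition gauge (R : realType) (X : metricType R) (s : R) (U : set X) :
    \bar R :=
  if U == set0 then 0%E else poweR (diam U) s.

Definition delta_cover (R : realType) (X : metricType R) (delta : R)
    (A : set X) : set (set X)^nat :=
  [set U | A `<=` \bigcup_k U k /\ forall k, (diam (U k) <= delta%:E)%E].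

Definition hausdorff_content (R : realType) (X : metricType R)
    (s delta : R) (A : set X) : \bar R :=
  ereal_inf [set (\sum_(0 <= k <oo) gauge s (U k))%E
            | U in delta_cover delta A].

Definition hausdorff_measure (R : realType) (X : metricType R)
    (s : R) (A : set X) : \bar R :=
  ereal_sup [set hausdorff_content s delta A | delta in [set e : R | 0 < e]].

Definition hausdorff_dim (R : realType) (X : metricType R) (A : set X) :
    \bar R :=
  ereal_inf [set s%:E | s in [set s : R | (0 <= s)%R /\ (hausdorff_measure s A = 0)%E]].

(* The circle R/Z is identified with [0, 1[, and its subsets are measured with
   the distance |x - y| of R; the circle distance is locally the same except at
   0, and yields the same Hausdorff dimension. *)
Definition heavy_f (R : realType) (x : R) : R :=
  \1_(`[0, 2^-1]%classic) x - \1_(`]2^-1, 1[%classic) x.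

Definition rotation (R : realType) (theta x : R) : R :=
  (x + theta) - (Num.floor (x + theta))%:~R.

Definition birkhoff_sum (R : realType) (theta : R) (n : nat) (x : R) : R :=
  \sum_(i < n) heavy_f (iter i (rotation theta) x).

Definition heavy_set (R : realType) (theta : R) : set R :=
  [set x : R | 0 <= x < 1 /\
     forall n : nat, (0 < n)%N -> 0 <= birkhoff_sum theta n x].

(* Main.v *)
(* Replacing [0, 1/2] by [0, 1/2[ changes the heavy set by a countable set only.
   For theta = 1/2 + e with 0 < e < 1/2 the signs along an orbit alternate except
   when the orbit crosses 0 or 1/2, and the signs at the crossings form the sign
   sequence of a rotation by theta' = 1/2 - 1/(4e).  If e = 1/(4(m - t)) with
   0 < t < 1/2, then theta' = 1/2 + t mod 1 and the heavy set of theta consists of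
   m translates of the heavy set of 1/2 + t scaled by 2e.

   Iterating, e is expanded along integers m >= 1; m >= 2 branches into m copies
   at ratio about 1/(2m), whereas n consecutive steps m = 1 only contract, by a
   factor about 1/(n+1).  Taking m = k + 2 followed by n + 1 ~ m^(1/d - 1) trivial
   steps at stage k gives a homogeneous Cantor set of dimension d.  Both e -> 1/(4(m - e))
   and e -> 1/(4(m + e)) preserve the dimension and their compositions send points
   near 0 and 1/2 close to any given rational, whence the density. *)

Require Import Defs.
From HB Require Import structures.
From mathcomp Require Import all_boot all_order all_algebra.
From mathcomp Require Import all_classical all_reals all_analysis.
From mathcomp Require Import zify ring lra.

Set Implicit Arguments.
Unset Strict Implicit.
Unset Printing Implicit Defensive.

Import Order.TTheory GRing.Theory Num.Theory.
Import numFieldNormedType.Exports.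

Local Open Scope classical_set_scope.
Local Open Scope ring_scope.

(** * Renormalization *)

(** An infinite expansion has no innermost level from which heaviness could be carried outwards.
    Truncating in time replaces it: up to time 0 heaviness is free, and each inverse branch gains
    one unit of time. The expansions themselves, that of the angle and that of a point with given
    digits, are both limits of backward compositions of monotone maps.

    No measure is built on the Cantor set. Its points are read along the mixed-radix digits of a
    number [y] in [0, 1[, and the way back from the point to [y] is Hoelder, so that a null heavy
    set would make [0, 1[ Lebesgue null.

    The contraction ratios are known only up to a factor 2, an error that compounds over the levels.
    This is why the integers [m] grow: each level then gains a power of its own size, which beats
    any constant. Blocks with [m >= 2] also keep the angles below 1/6, away from the parabolic point
    1/2, where the contraction of [n] trivial steps would no longer be comparable to 1/(n + 1). *)

(* The 1-periodic function equal to 1 on [0, 1/2[ and -1 on [1/2, 1[. *)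
Definition square_wave {R : realType} (z : R) : R := (-1) ^ Num.floor (2 * z).

Definition wave_sum {R : realType} (theta x : R) (n : nat) : R :=
  \sum_(i < n) square_wave (x + theta * i%:R).

Definition wave_heavy {R : realType} (theta : R) : set R :=
  [set x | 0 <= x < 1 /\ forall n, 0 <= wave_sum theta x n].

Lemma square_waveE {R : realType} (z : R) (k : int) :
  k%:~R <= 2 * z < (k + 1)%:~R -> square_wave z = (-1) ^ k.
Proof. by move=> h; rewrite /square_wave (floor_def h). Qed.

Lemma square_wave_pm {R : realType} (z : R) :
  square_wave z = 1 \/ square_wave z = -1.
Proof.
rewrite /square_wave; case: (Num.floor _) => n.
  rewrite -exprnP -signr_odd; case: odd; [by right | by left].
rewrite NegzE -exprnN -signr_odd; case: odd => /=; [right | left].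
  by rewrite expr1 invrN invr1.
by rewrite expr0 invr1.
Qed.

Lemma square_waveDhalf {R : realType} (z : R) (k : int) :
  square_wave (z + k%:~R / 2) = (-1) ^ k * square_wave z.
Proof.
rewrite /square_wave mulrDr mulrCA divff ?pnatr_eq0// mulr1.
by rewrite floorDrz ?intr_int// intrKfloor expfzDr ?oppr_eq0 ?oner_eq0// mulrC.
Qed.

Lemma signzD2 {R : realType} (a b : int) : (-1 : R) ^ (a + b * 2) = (-1) ^ a.
Proof.
rewrite expfzDr ?oppr_eq0 ?oner_eq0// [b * 2]mulrC -exprz_exp.
by rewrite -(exprnP _ 2) sqrrN expr1n exp1rz mulr1.
Qed.

Lemma square_waveDint {R : realType} (z : R) (k : int) :
  square_wave (z + k%:~R) = square_wave z.
Proof.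
have -> : k%:~R = (k * 2)%:~R / 2 :> R.
  by rewrite intrM mulfK ?pnatr_eq0.
by rewrite square_waveDhalf -[k * 2]add0r signzD2 expr0z mul1r.
Qed.

Lemma wave_sumS {R : realType} (theta x : R) (n : nat) :
  wave_sum theta x n.+1 =
  wave_sum theta x n + square_wave (x + theta * n%:R).
Proof. by rewrite /wave_sum big_ord_recr. Qed.

Lemma wave_sum0 {R : realType} (theta x : R) : wave_sum theta x 0 = 0.
Proof. by rewrite /wave_sum big_ord0. Qed.

Lemma wave_sumDint {R : realType} (theta x : R) (k l : int) (n : nat) :
  wave_sum (theta + k%:~R) (x + l%:~R) n = wave_sum theta x n.
Proof.
apply: eq_bigr => i _.
rewrite -[RHS](square_waveDint _ (l + k * i%:Z)); congr square_wave.
by rewrite rmorphD rmorphM/= mulrDl; ring.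
Qed.

Lemma wave_heavy_lt_half {R : realType} (theta x : R) :
  wave_heavy theta x -> 0 <= x < 1 / 2.
Proof.
move=> [/andP[x0 x1] /(_ 1%N)]; rewrite wave_sumS wave_sum0 mulr0 addr0 add0r.
rewrite x0/=; case: ltP => // xh.
rewrite (@square_waveE _ _ 1) ?expr1z; first by rewrite oppr_ge0 ler10.
by apply/andP; split; rewrite ?intrD; lra.
Qed.

Lemma square_wave_half_rotation {R : realType} (eps x : R) (N : nat) (k : int) :
  Num.floor (2 * x + 2 * eps * N%:R) = k ->
  square_wave (x + (1 / 2 + eps) * N%:R) = (-1) ^ (k + N%:Z).
Proof.
move=> /eqP; rewrite floor_eq intrD => kN; apply: square_waveE.
by rewrite !intrD; lra.
Qed.

(** The quotient (k + 1 - 2x) / (2 eps) is the real time at which 2x + 2 eps s crosses the integer k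
    + 1. It lies in ]N, N + 1], and twice the point of the return orbit is k + 1 minus this time,
    which determines its floor. *)
Lemma square_wave_return {R : realType} (eps x : R) (N k : nat) :
  0 < eps ->
  2 * x + 2 * eps * N%:R < k.+1%:R <= 2 * x + 2 * eps * N.+1%:R ->
  let theta' := 1 / 2 - (4 * eps)^-1 in
  square_wave (x / (2 * eps) + theta' + theta' * k%:R) =
  (-1) ^ (k.+1%:Z + N.+1%:Z).
Proof.
move=> eps0 /andP[kN kN1] theta'; rewrite /theta'.
have -> : k.+1%:Z + N.+1%:Z = k.+1%:Z - N.+1%:Z + N.+1%:Z * 2 by lia.
rewrite signzD2; apply: square_waveE.
have -> : 2 * (x / (2 * eps) + (1 / 2 - (4 * eps)^-1) +
    (1 / 2 - (4 * eps)^-1) * k%:R) = k.+1%:R - (k.+1%:R - 2 * x) / (2 * eps).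
  by rewrite -natr1; field; rewrite gt_eqF.
have h1 : (k.+1%:R - 2 * x) / (2 * eps) <= N.+1%:R.
  by rewrite ler_pdivrMr; lra.
have h2 : N%:R < (k.+1%:R - 2 * x) / (2 * eps).
  by rewrite ltr_pdivlMr; lra.
rewrite !intrD !mulrNz; rewrite -!natr1 in h1 h2 *.
by apply/andP; split; rewrite -?pmulrn -?natr1; lra.
Qed.

(* While [N] runs over the times with [floor (2 x + 2 eps N) = k] the signs
   alternate, so such a block contributes at most its first sign, which is the
   [k]-th sign of the orbit of [y] under the rotation by [theta']. *)
Lemma wave_sum_renorm {R : realType} (eps x : R) (N : nat) :
  0 < eps < 1 / 2 -> 0 <= x < 1 / 2 ->
  let theta' := 1 / 2 - (4 * eps)^-1 in
  exists k : nat, [/\ (k <= N)%N,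
    Num.floor (2 * x + 2 * eps * N%:R) = k%:Z &
    wave_sum (1 / 2 + eps) x N.+1 =
    wave_sum theta' (x / (2 * eps) + theta') k +
    (square_wave (x + (1 / 2 + eps) * N%:R) == 1)%:R].
Proof.
move=> /andP[eps0 eps1] /andP[x0 x1] theta'.
elim: N => [|N [k [kN floork IH]]].
  exists 0%N; split=> //; first by apply: floor_def; rewrite intrD; lra.
  rewrite wave_sumS !wave_sum0 !add0r mulr0 addr0.
  have -> : square_wave x = 1 by rewrite (@square_waveE _ _ 0) ?intrD; lra.
  by rewrite eqxx.
have swN := square_wave_half_rotation floork.
have /andP[lk uk] := floor_itv (2 * x + 2 * eps * N%:R).
rewrite floork intrD -!pmulrn in lk uk.
have [kN1|kN1] := ltP (2 * x + 2 * eps * N.+1%:R) k.+1%:R.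
  exists k; split; [exact: leqW | |].
    by apply: floor_def; rewrite intrD -!pmulrn; rewrite -!natr1 in kN1 *; lra.
  have floork1 : Num.floor (2 * x + 2 * eps * N.+1%:R) = k%:Z.
    by apply: floor_def; rewrite intrD -!pmulrn; rewrite -!natr1 in kN1 *; lra.
  rewrite wave_sumS IH (square_wave_half_rotation floork1) swN.
  have -> : k%:Z + N.+1%:Z = 1 + (k%:Z + N%:Z) by lia.
  rewrite [(-1) ^ (1 + _)]expfzDr ?oppr_eq0 ?oner_eq0// -swN -(exprnP _ 1) expr1.
  have m1 : (-1 == 1 :> R) = false by apply/eqP => h; lra.
  by case: (square_wave_pm (x + (1 / 2 + eps) * N%:R)) => ->;
    rewrite ?mulN1r ?opprK ?eqxx ?m1/=; ring.
(* Since 2 eps < 1, exactly one integer is crossed. Then [k] and [N] both grow by one, so the sign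
   is repeated: the indicator keeps its value and the repeated sign is the new return term. *)
exists k.+1.
have floork1 : Num.floor (2 * x + 2 * eps * N.+1%:R) = k.+1%:Z.
  apply: floor_def; rewrite intrD -!pmulrn kN1/=.
  have N1 : N.+1%:R = N%:R + 1 :> R by rewrite natr1.
  have k1 : k.+1%:R = k%:R + 1 :> R by rewrite natr1.
  by rewrite N1; lra.
split=> //.
rewrite wave_sumS [in RHS]wave_sumS IH.
have -> : square_wave (x / (2 * eps) + theta' + theta' * k%:R) =
          square_wave (x + (1 / 2 + eps) * N.+1%:R).
  rewrite (square_wave_half_rotation floork1); apply: square_wave_return => //.
  by rewrite kN1 andbT -[k.+1%:R]natr1.
have -> : square_wave (x + (1 / 2 + eps) * N%:R) =
          square_wave (x + (1 / 2 + eps) * N.+1%:R).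
  rewrite swN (square_wave_half_rotation floork1).
  have -> : k.+1%:Z + N.+1%:Z = k%:Z + N%:Z + 1 * 2 by lia.
  by rewrite signzD2.
by rewrite addrAC.
Qed.

(** At most one integer is crossed per step, so the sum over [N.+1] terms involves at most [N]
    return terms. This is the unit of time gained by a branch. *)
Lemma wave_sum_ge0_renorm {R : realType} (eps x : R) (N : nat) :
  0 < eps < 1 / 2 -> 0 <= x < 1 / 2 ->
  let theta' := 1 / 2 - (4 * eps)^-1 in
  (forall n, (n <= N)%N -> 0 <= wave_sum theta' (x / (2 * eps) + theta') n) ->
  forall n, (n <= N.+1)%N -> 0 <= wave_sum (1 / 2 + eps) x n.
Proof.
move=> heps hx theta' H [_|n nN]; first by rewrite wave_sum0.
have [k [kn _ ->]] := wave_sum_renorm n heps hx.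
by rewrite addr_ge0// H// (leq_trans kn).
Qed.

(** Look at the time when [n.+1] is crossed. If the last return sign is -1, the indicator vanishes
    and the return sum is itself an original sum; if it is 1, the return sum has just increased. *)
Lemma wave_sum_ge0_return {R : realType} (eps x : R) :
  0 < eps < 1 / 2 -> 0 <= x < 1 / 2 ->
  (forall n, 0 <= wave_sum (1 / 2 + eps) x n) ->
  let theta' := 1 / 2 - (4 * eps)^-1 in
  forall n, 0 <= wave_sum theta' (x / (2 * eps) + theta') n.
Proof.
move=> heps hx H theta'; elim=> [|n IH]; first by rewrite wave_sum0.
have /andP[eps0 eps1] := heps; have /andP[x0 x1] := hx.
pose u := (n.+1%:R - 2 * x) / (2 * eps).
have u0 : 0 < u by rewrite divr_gt0//; [rewrite -natr1; have := ler0n R n; lra|lra].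
(* The crossing time is rounded up, as [square_wave] takes its new value at the jump itself; hence
   the shift by one when [u] is an integer. *)
have : exists N : nat, N%:R < u <= N.+1%:R.
  pose N := Num.truncn u.
  have /andP[Nu uN] : N%:R <= u < N.+1%:R by apply: truncn_itv; exact: ltW.
  have [Nltu|] := ltP N%:R u; first by exists N; rewrite Nltu ltW.
  move: Nu; case: N uN => [_ _|N uN Nu uN']; first by move=> /(lt_le_trans u0); rewrite ltxx.
  by exists N; rewrite uN' andbT (lt_le_trans _ Nu)// ltr_nat.
move=> [N /andP[]]; rewrite /u ltr_pdivlMr; last lra.
rewrite ler_pdivrMr; last lra.
move=> Nlt leN.
have floorN : Num.floor (2 * x + 2 * eps * N.+1%:R) = n.+1%:Z.
  by apply: floor_def; rewrite intrD -!pmulrn; rewrite -!natr1 in Nlt leN *; lra.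
have sw : square_wave (x / (2 * eps) + theta' + theta' * n%:R) =
          square_wave (x + (1 / 2 + eps) * N.+1%:R).
  rewrite (square_wave_half_rotation floorN); apply: square_wave_return => //.
  by apply/andP; split; lra.
have := wave_sum_renorm N.+1 heps hx => -[k [_]]; rewrite floorN => -[<-].
have m1 : (-1 == 1 :> R) = false by apply/eqP => h; lra.
move=> S; have := H N.+2; rewrite S -sw [wave_sum _ _ n.+1]wave_sumS.
case: (square_wave_pm (x / (2 * eps) + theta' + theta' * n%:R)) => ->.
  by move=> _; rewrite addr_ge0.
by rewrite m1 addr0.
Qed.

(** * Inverse branches of the renormalization *)

Definition phi {R : realType} (m : nat) (t : R) : R := (4 * (m%:R - t))^-1.

(** The bound [x < 1 / 2] is built in because the sums say nothing about [x] at [N = 0], where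
    inductions on time start. *)
Definition heavy_upto {R : realType} (theta x : R) (N : nat) : Prop :=
  0 <= x < 1 / 2 /\ forall n, (n <= N)%N -> 0 <= wave_sum theta x n.

Lemma wave_heavyP {R : realType} (theta x : R) :
  wave_heavy theta x <-> forall N, heavy_upto theta x N.
Proof.
split=> [hx N|H]; first by split=> [|n _]; [exact: wave_heavy_lt_half hx | case: hx].
have [/andP[x0 x1] _] := H 0%N.
by split=> [|n]; [rewrite x0; lra | have [_] := H n; exact].
Qed.

Lemma heavy_upto_le {R : realType} (theta x : R) (M N : nat) :
  (M <= N)%N -> heavy_upto theta x N -> heavy_upto theta x M.
Proof. by move=> MN [hx H]; split=> // n nM; apply: H; exact: leq_trans MN. Qed.

Lemma phi_gt0_lt_half {R : realType} (m : nat) (t : R) :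
  (0 < m)%N -> - (1 / 2) < t < 1 / 2 -> 0 < phi m t < 1 / 2.
Proof.
move=> m0 /andP[t0 t1]; have m1 : 1 <= m%:R :> R by rewrite ler1n.
rewrite /phi invr_gt0 mulr_gt0//=; last lra.
by rewrite -div1r ltr_pdivrMr; lra.
Qed.

Lemma phi_return_angle {R : realType} (m : nat) (t : R) :
  (0 < m)%N -> - (1 / 2) < t < 1 / 2 ->
  1 / 2 - (4 * phi m t)^-1 = 1 / 2 + t + (- m%:Z)%:~R.
Proof.
move=> m0 /andP[t0 t1]; have m1 : 1 <= m%:R :> R by rewrite ler1n.
rewrite /phi mulrNz -pmulrn; field.
by rewrite gt_eqF//; lra.
Qed.

(* [h] is heavy for [1/2 + t] iff its image by a branch with [0 <= i < m] is heavy
   for [1/2 + phi m t]; for [t < 0] part of the branch [i = -1] also occurs. *)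
Definition phi_branch {R : realType} (m : nat) (t : R) (i : int) (h : R) : R :=
  (h + i%:~R + (1 / 2 - t)) / (2 * (m%:R - t)).

Lemma wave_sum_phi_branch {R : realType} (m : nat) (t h : R) (i : int) n :
  (0 < m)%N -> - (1 / 2) < t < 1 / 2 ->
  let theta' := 1 / 2 - (4 * phi m t)^-1 in
  wave_sum theta' (phi_branch m t i h / (2 * phi m t) + theta') n =
  wave_sum (1 / 2 + t) h n.
Proof.
move=> m0 ht /=; rewrite phi_return_angle//.
rewrite -(wave_sumDint (1 / 2 + t) h (- m%:Z) (i + 1 - m%:Z)); congr wave_sum.
case/andP: ht => t0 t1; have m1 : 1 <= m%:R :> R by rewrite ler1n.
rewrite /phi_branch /phi intrB intrD mulrNz -!pmulrn; field.
by rewrite gt_eqF//; lra.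
Qed.

Lemma phi_branch_heavy_upto {R : realType} (m : nat) (t h : R) (i N : nat) :
  - (1 / 2) < t < 1 / 2 -> (i < m)%N -> heavy_upto (1 / 2 + t) h N ->
  heavy_upto (1 / 2 + phi m t) (phi_branch m t i h) N.+1.
Proof.
move=> ht im [/andP[h0 h1] H]; have m0 : (0 < m)%N := leq_ltn_trans (leq0n i) im.
have hx : 0 <= phi_branch m t i h < 1 / 2.
  case/andP: ht => t0 t1; have m1 : 1 <= m%:R :> R by rewrite ler1n.
  have i1 : i%:R + 1 <= m%:R :> R by rewrite natr1 ler_nat.
  have i0 : 0 <= i%:R :> R by rewrite ler0n.
  rewrite /phi_branch -pmulrn divr_ge0//=; [|lra|lra].
  by rewrite ltr_pdivrMr; lra.
split=> //; apply: wave_sum_ge0_renorm => //; first exact: phi_gt0_lt_half.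
by move=> n nN; rewrite wave_sum_phi_branch//; exact: H.
Qed.

Lemma wave_heavy_phi_branch {R : realType} (m : nat) (t x : R) :
  (0 < m)%N -> - (1 / 2) < t < 1 / 2 -> wave_heavy (1 / 2 + phi m t) x ->
  exists h, exists i : int, [/\ wave_heavy (1 / 2 + t) h, -1 <= i < m%:Z,
    0 <= t -> 0 <= i & x = phi_branch m t i h].
Proof.
move=> m0 ht hx.
have /andP[x0 x1] := wave_heavy_lt_half hx.
have [t0 t1] := andP ht; have m1 : 1 <= m%:R :> R by rewrite ler1n.
pose z := 2 * (m%:R - t) * x - (1 / 2 - t).
pose i := Num.floor z.
have /andP[iz zi] := floor_itv z; rewrite -/i intrD in iz zi.
have xE : x = phi_branch m t i (z - i%:~R).
  by rewrite /phi_branch /z; field; rewrite gt_eqF//; lra.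
have hh : wave_heavy (1 / 2 + t) (z - i%:~R).
  split=> [|n]; first by lra.
  rewrite -(wave_sum_phi_branch _ i n m0 ht) -xE.
  apply: wave_sum_ge0_return; [exact: phi_gt0_lt_half | by rewrite x0 | by case: hx].
have zx : - (1 / 2 - t) <= z by rewrite /z lerDr; apply: mulr_ge0 => //; lra.
exists (z - i%:~R), i; split => //.
  apply/andP; split.
    by rewrite -ltzD1 -[X in _ < X]addrC -(ltr_int R) intrD; lra.
  rewrite -(ltr_int R) -pmulrn; apply: (le_lt_trans iz).
  have : (m%:R - t) * x <= (m%:R - t) * (1 / 2) by apply: ler_wpM2l; lra.
  by rewrite /z; lra.
(* For [i = -1] the point [z - i%:~R] would be at least 1/2 + t, beyond the range of heavy
   points. *)
move=> t_ge0; have /andP[_ hlt] := wave_heavy_lt_half hh.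
by rewrite -ltzD1 -(ltr_int R) intrD; lra.
Qed.

(* The [n]-th iterate of [phi 1], which is parabolic at [1 / 2]. *)
Definition phi1_iter {R : realType} (n : nat) (t : R) : R :=
  (1 - (1 - 2 * t) / (1 + n%:R * (1 - 2 * t))) / 2.

(** Closed form of the composite of [n] branches with [m = 1], [i = 0] along the orbit of [t]. It is
    affine in [h] and fixes 1/2. *)
Definition phi1_branch {R : realType} (n : nat) (t h : R) : R :=
  (h + n%:R * (1 - 2 * t) / 2) / (1 + n%:R * (1 - 2 * t)).

Lemma phi1_denom_ge1 {R : realType} (n : nat) (t : R) :
  t <= 1 / 2 -> 1 <= 1 + n%:R * (1 - 2 * t).
Proof. by move=> t1; rewrite lerDl mulr_ge0//; lra. Qed.

Lemma phi1_iter_itv {R : realType} (n : nat) (t : R) :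
  0 < t < 1 / 2 -> 0 < phi1_iter n t < 1 / 2.
Proof.
move=> /andP[t0 t1]; have k1 := phi1_denom_ge1 n (ltW t1).
rewrite /phi1_iter; set k := 1 + _ in k1 *.
have h1 : (1 - 2 * t) / k <= 1 - 2 * t by rewrite ler_pdivrMr; [nra|lra].
have h2 : 0 < (1 - 2 * t) / k by apply: divr_gt0; lra.
by apply/andP; split; lra.
Qed.

Lemma phi1_iter_ge0_lt {R : realType} (n : nat) (t : R) :
  0 <= t < 1 / 2 -> 0 <= phi1_iter n t < 1 / 2.
Proof.
move=> /andP[]; rewrite le_eqVlt => /predU1P[<- _|t0 t1].
  have n0 : 0 <= n%:R :> R by [].
  rewrite /phi1_iter mulr0 subr0 mulr1.
  have h1 : 1 / (1 + n%:R) <= 1 :> R by rewrite ler_pdivrMr; lra.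
  have h2 : 0 < 1 / (1 + n%:R) :> R by apply: divr_gt0; lra.
  by apply/andP; split; lra.
by have := @phi1_iter_itv _ n t; rewrite t0 t1 => /(_ isT); lra.
Qed.

Lemma phi1_iterS {R : realType} (n : nat) (t : R) :
  t < 1 / 2 -> phi1_iter n.+1 t = phi 1 (phi1_iter n t).
Proof.
move=> t1; have k1 := phi1_denom_ge1 n (ltW t1).
rewrite /phi1_iter /phi -natr1; field.
by rewrite !gt_eqF//; lra.
Qed.

Lemma phi1_iter0 {R : realType} (t : R) : phi1_iter 0 t = t.
Proof. by rewrite /phi1_iter; field. Qed.

Lemma phi1_branch0 {R : realType} (t h : R) : phi1_branch 0 t h = h.
Proof. by rewrite /phi1_branch; field. Qed.

Lemma phi1_branchS {R : realType} (n : nat) (t h : R) : t < 1 / 2 ->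
  phi1_branch n.+1 t h = phi_branch 1 (phi1_iter n t) 0 (phi1_branch n t h).
Proof.
move=> t1; have k1 := phi1_denom_ge1 n (ltW t1).
rewrite /phi1_branch /phi_branch /phi1_iter -natr1; field.
by rewrite !gt_eqF//; lra.
Qed.

Lemma phi1_branch_heavy_upto {R : realType} (n : nat) (t h : R) (N : nat) :
  0 < t < 1 / 2 -> heavy_upto (1 / 2 + t) h N ->
  heavy_upto (1 / 2 + phi1_iter n t) (phi1_branch n t h) N.
Proof.
move=> ht hh; have /andP[t0 t1] := ht.
elim: n => [|n IH]; first by rewrite phi1_iter0 phi1_branch0.
rewrite phi1_iterS// phi1_branchS//; apply: (heavy_upto_le (leqnSn N)).
apply: (@phi_branch_heavy_upto _ 1 _ _ 0) => //.
by have := phi1_iter_itv n ht; lra.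
Qed.

Lemma wave_heavy_phi1_branch {R : realType} (n : nat) (t x : R) :
  0 < t < 1 / 2 -> wave_heavy (1 / 2 + phi1_iter n t) x ->
  exists2 h, wave_heavy (1 / 2 + t) h & x = phi1_branch n t h.
Proof.
move=> ht; have /andP[t0 t1] := ht.
elim: n x => [|n IH] x.
  by rewrite phi1_iter0 => hx; exists x => //; rewrite phi1_branch0.
rewrite phi1_iterS// => /wave_heavy_phi_branch[//||h [i [hh]]].
  by have := phi1_iter_itv n ht; lra.
move=> /andP[_ i1] i0 ->.
have -> : i = 0.
  have : 0 <= i by apply: i0; have := phi1_iter_itv n ht; lra.
  by move: i1; lia.
by have [g hg ->] := IH _ hh; exists g => //; rewrite phi1_branchS.
Qed.

(** * Blocks: one branching step after a run of trivial steps *)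

Definition block {R : realType} (m n : nat) (t : R) : R := phi m (phi1_iter n t).

Definition block_branch {R : realType} (m n : nat) (t : R) (i : nat) (h : R) : R :=
  phi_branch m (phi1_iter n t) i (phi1_branch n t h).

(** The slope of [block_branch] in [h]. The slope of [phi_branch m] and the distance between its
    consecutive branches are the same number 1/(2(m - t)) = 2 phi m t; the denominator comes from
    the trivial steps. *)
Definition block_ratio {R : realType} (m n : nat) (t : R) : R :=
  2 * block m n t / (1 + n%:R * (1 - 2 * t)).

Lemma block_branch_heavy_upto {R : realType} (m n : nat) (t h : R) (i N : nat) :
  0 < t < 1 / 2 -> (i < m)%N -> heavy_upto (1 / 2 + t) h N ->
  heavy_upto (1 / 2 + block m n t) (block_branch m n t i h) N.+1.
Proof.
move=> ht im hh; apply: phi_branch_heavy_upto => //.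
  by have := phi1_iter_itv n ht; lra.
exact: phi1_branch_heavy_upto.
Qed.

Lemma wave_heavy_block_branch {R : realType} (m n : nat) (t x : R) :
  (0 < m)%N -> 0 < t < 1 / 2 -> wave_heavy (1 / 2 + block m n t) x ->
  exists h, exists2 i, (i < m)%N &
    wave_heavy (1 / 2 + t) h /\ x = block_branch m n t i h.
Proof.
move=> m0 ht; have hn := phi1_iter_itv n ht.
move=> /wave_heavy_phi_branch[//||h [i [hh /andP[_ im] i0 ->]]]; first lra.
have {i0} : 0 <= i by apply: i0; lra.
case: i im => // i im _.
have [g hg ->] := wave_heavy_phi1_branch ht hh.
by exists g, i.
Qed.

Lemma block_gt0_lt {R : realType} (m n : nat) (t : R) :
  (2 <= m)%N -> 0 <= t < 1 / 2 -> 0 < block m n t < 1 / 6.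
Proof.
move=> m2 /(phi1_iter_ge0_lt n) /andP[u0 u1].
have m2R : 2 <= m%:R :> R by rewrite ler_nat.
rewrite /block /phi invr_gt0 -div1r ltr_pdivrMr; last lra.
by apply/andP; split; lra.
Qed.

Lemma block_branchB {R : realType} (m n : nat) (t : R) (i j : nat) (h g : R) :
  (0 < m)%N -> 0 < t < 1 / 2 ->
  block_branch m n t i h - block_branch m n t j g =
  2 * block m n t * (i%:R - j%:R) + block_ratio m n t * (h - g).
Proof.
move=> m0 ht; have /andP[t0 t1] := ht; have m1 : 1 <= m%:R :> R by rewrite ler1n.
have /andP[u0 u1] := phi1_iter_itv n ht; have k1 := phi1_denom_ge1 n (ltW t1).
rewrite /block_ratio /block_branch /phi_branch /phi1_branch /block /phi.
set u := phi1_iter n t in u0 u1 *; rewrite -!pmulrn; field.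
by rewrite !gt_eqF//; lra.
Qed.

(** The top branch fixes 1/2; measuring distances from 1/2 shows that all branches preserve [0, 1/2]
    and which ones can reach its end. *)
Lemma block_branch_max {R : realType} (m n : nat) (t : R) :
  (0 < m)%N -> 0 < t < 1 / 2 ->
  block_branch m n t m.-1 (1 / 2) = 1 / 2.
Proof.
move=> m0 ht; have /andP[t0 t1] := ht; have m1 : 1 <= m%:R :> R by rewrite ler1n.
have /andP[u0 u1] := phi1_iter_itv n ht; have k1 := phi1_denom_ge1 n (ltW t1).
rewrite /block_branch /phi_branch /phi1_branch -pmulrn.
have -> : m.-1%:R = m%:R - 1 :> R by rewrite -subn1 natrB.
have -> : (1 / 2 + n%:R * (1 - 2 * t) / 2) / (1 + n%:R * (1 - 2 * t)) = 1 / 2 :> R.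
  by field; rewrite gt_eqF//; lra.
by field; rewrite gt_eqF//; lra.
Qed.

Lemma block_ge {R : realType} (m n : nat) (t : R) :
  (0 < m)%N -> 0 < t < 1 / 2 -> (4 * m%:R)^-1 <= block m n t.
Proof.
move=> m0 ht; have m1 : 1 <= m%:R :> R by rewrite ler1n.
have /andP[u0 u1] := phi1_iter_itv n ht.
by rewrite /block /phi lef_pV2 ?posrE; lra.
Qed.

Lemma block_ratio_bounds {R : realType} (m n : nat) (t : R) :
  (2 <= m)%N -> 0 < t < 1 / 6 ->
  (2 * (m * n.+1)%:R)^-1 <= block_ratio m n t <= (m * n.+1)%:R^-1.
Proof.
move=> m2 /andP[t0 t1]; have ht : 0 < t < 1 / 2 by lra.
have m2R : 2 <= m%:R :> R by rewrite ler_nat.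
have /andP[u0 u1] := phi1_iter_itv n ht; have th : t <= 1 / 2 by lra.
have k1 := phi1_denom_ge1 n th; have n0 : 0 <= n%:R :> R by [].
rewrite natrM -natr1.
set u := phi1_iter n t in u0 u1 *; set k := 1 + _ in k1 *.
have kl : 2 * (n%:R + 1) <= 3 * k by rewrite /k; nra.
have ku : k <= n%:R + 1 by rewrite /k; nra.
have mu : 0 < m%:R - u by lra.
have -> : block_ratio m n t = (2 * (m%:R - u) * k)^-1.
  rewrite /block_ratio /block /phi -/u -/k; field.
  by rewrite !gt_eqF//; lra.
have d0 : 0 < 2 * (m%:R - u) * k by apply: mulr_gt0; lra.
have mn0 : 0 < m%:R * (n%:R + 1) :> R by apply: mulr_gt0; lra.
rewrite !lef_pV2 ?posrE//; [|lra..].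
apply/andP; split.
  rewrite -mulrA ler_pM2l//; apply: ler_pM; lra.
(* Here m - u >= 3m/4 and k >= 2(n + 1)/3, and the constants 2, 3/4 and 2/3 multiply to exactly
   1. *)
have : 3 / 2 * m%:R * (2 * (n%:R + 1)) <= 2 * (m%:R - u) * (3 * k).
  by apply: ler_pM; lra.
by rewrite -/k; lra.
Qed.

(** * Null sets of Hausdorff measures *)

(* For [0 < s] this is equivalent to the vanishing of the [s]-dimensional
   Hausdorff measure: small total weight forces small radii. *)
Definition gauge_null {R : realType} (s : R) (A : set R) : Prop :=
  forall eta : R, 0 < eta -> exists c r : nat -> R,
    [/\ forall k, 0 <= r k,
        forall x, A x -> exists k, `|x - c k| <= r k &
        forall n, \sum_(k < n) r k `^ s <= eta].

Lemma gauge_ge0 {R : realType} {X : metricType R} (s : R) (U : set X) :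
  (0 <= gauge s U)%E.
Proof. by rewrite /gauge; case: ifP => // _; exact: poweR_ge0. Qed.

Lemma diam_le {R : realType} {X : metricType R} (U : set X) (b : R) :
  (forall x y, U x -> U y -> mdist x y <= b) -> (diam U <= b%:E)%E.
Proof.
move=> H; apply: ge_ereal_sup => _ [[x y] [/= Ux Uy] <-].
by rewrite lee_fin; exact: H.
Qed.

Lemma le_diam {R : realType} {X : metricType R} (U : set X) (x y : X) :
  U x -> U y -> ((mdist x y)%:E <= diam U)%E.
Proof. by move=> Ux Uy; apply: ereal_sup_ubound; exists (x, y). Qed.

Lemma diam_fin_num {R : realType} {X : metricType R} (U : set X) (x : X) (b : R) :
  U x -> (diam U <= b%:E)%E -> diam U \is a fin_num /\ 0 <= fine (diam U) <= b.
Proof.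
move=> Ux Ub; have U0 : (0 <= diam U)%E.
  by apply: le_trans (le_diam Ux Ux); rewrite lee_fin mdist_ge0.
have fU : diam U \is a fin_num by rewrite ge0_fin_numE// (le_lt_trans Ub) ?ltry.
by split=> //; rewrite fine_ge0//= -lee_fin fineK.
Qed.

Lemma gauge_closed_ball {R : realType} (s c r : R) : 0 < s -> 0 <= r ->
  (gauge s [set x : R^o | (`|x - c| <= r)%R] <= ((2 * r) `^ s)%:E)%E.
Proof.
move=> s0 r0; rewrite /gauge; case: ifP => _; first by rewrite lee_fin powR_ge0.
have dU : (diam [set x : R^o | (`|x - c| <= r)%R] <= (2 * r)%:E)%E.
  apply: diam_le => x y /= xc yc.
  have -> : mdist x y = `|(y - c) - (x - c)| by rewrite opprB addrA subrK.
  by rewrite (le_trans (ler_normB _ _))//; lra.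
have Uc : [set x : R^o | (`|x - c| <= r)%R] c by rewrite /= subrr normr0.
have [fd /andP[d0 d1]] := diam_fin_num Uc dU.
rewrite -(fineK fd) poweR_EFin lee_fin ge0_ler_powR ?nnegrE//; first exact: ltW.
by rewrite mulr_ge0.
Qed.

Lemma hausdorff_measure_eq0 {R : realType} (s : R) (A : set R) : 0 < s ->
  gauge_null s A -> hausdorff_measure s (A : set R^o) = 0%E.
Proof.
move=> s0 HA.
have content0 delta : 0 < delta -> hausdorff_content s delta (A : set R^o) = 0%E.
  move=> delta0; apply/eqP; rewrite eq_le; apply/andP; split; last first.
    apply: le_ereal_inf_tmp => _ [U _ <-]; apply: nneseries_ge0 => k _ _.
    exact: gauge_ge0.
  apply/lee_addgt0Pr => eta eta0; rewrite add0e.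
  have d20 : 0 < delta / 2 by rewrite divr_gt0.
  have s20 : 0 < 2 `^ s :> R by rewrite powR_gt0.
  (* The first bound pays for replacing radii by diameters in the sum; the second forces every
     single radius below delta/2. *)
  have e0 : 0 < Num.min (eta / 2 `^ s) ((delta / 2) `^ s).
    by rewrite lt_min divr_gt0//= powR_gt0.
  have [c [r [r0 Ac sumr]]] := HA _ e0.
  apply: ge_ereal_inf; exists (\sum_(0 <= k <oo)
    gauge s [set x : R^o | (`|x - c k| <= r k)%R])%E; last first.
    apply: lime_le; first by apply: is_cvg_nneseries => k _ _; exact: gauge_ge0.
    apply: nearW => n.
    apply: (@le_trans _ _ (\sum_(0 <= k < n) ((2 * r k) `^ s)%:E)%E).
      by apply: lee_sum => k _; exact: gauge_closed_ball.
    rewrite sumEFin lee_fin big_mkord.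
    under eq_bigr do rewrite powRM//.
    rewrite -mulr_sumr mulrC -ler_pdivlMr//.
    by rewrite (le_trans (sumr n))// ge_min lexx.
  exists (fun k => [set x : R^o | (`|x - c k| <= r k)%R]) => //.
  split=> [x /Ac[k xk]|k]; first by exists k.
  have rk : r k <= delta / 2.
    have : r k `^ s <= (delta / 2) `^ s.
      apply: (@le_trans _ _ (\sum_(j < k.+1) r j `^ s)); last first.
        by rewrite (le_trans (sumr _))// ge_min lexx orbT.
      by rewrite big_ord_recr/= lerDr sumr_ge0// => j _; exact: powR_ge0.
    by apply: contraTT; rewrite -!ltNge => h; apply: gt0_ltr_powR; rewrite ?nnegrE// ltW.
  apply: diam_le => x y /= xc yc.
  have -> : mdist x y = `|(y - c k) - (x - c k)| by rewrite opprB addrA subrK.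
  by rewrite (le_trans (ler_normB _ _))//; lra.
apply/eqP; rewrite eq_le; apply/andP; split.
  by apply: ge_ereal_sup => _ [delta /= delta0 <-]; rewrite content0.
by apply: ereal_sup_ubound; exists 1; [exact: ltr01 | exact: content0].
Qed.

(** Covers with [delta = 1] suffice: for diameters at most 1 a larger exponent weighs less. For
    [s' = 0] a one-point set weighs 1, which still dominates the weight 0 of a ball of radius 0. *)
Lemma gauge_null_of_hausdorff {R : realType} (s' s : R) (A : set R) :
  0 <= s' <= s -> 0 < s ->
  hausdorff_measure s' (A : set R^o) = 0%E -> gauge_null s A.
Proof.
move=> /andP[s'0 s's] s0 HA eta eta0.
have : (hausdorff_content s' 1 (A : set R^o) < eta%:E)%E.
  rewrite (@le_lt_trans _ _ 0%E) ?lte_fin// -HA.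
  by apply: ereal_sup_ubound; exists 1 => //; exact: ltr01.
move=> /ereal_inf_lt[_ [U [AU dU] <-] sumU].
pose r k := if U k == set0 then 0 else fine (diam (U k)).
have rE k : 0 <= r k /\ ((r k `^ s)%:E <= gauge s' (U k))%E.
  rewrite /r /gauge; case: ifPn => [_|/set0P[x Ux]].
    by rewrite powR0 ?lexx// gt_eqF.
  have [fd /andP[d0 d1]] := diam_fin_num Ux (dU k); split=> //.
  rewrite -[X in (_ <= poweR X _)%E](fineK fd) poweR_EFin lee_fin.
  move: d0; rewrite le_eqVlt => /predU1P[<-|d0]; last by rewrite ger_powR ?d0.
  by rewrite (powR0 (negbT (gt_eqF s0))) powR_ge0.
exists (fun k => xget 0 (U k)), r; split=> [k|x|n].
- by have [] := rE k.
- move=> /AU[k _ Ux]; exists k.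
  have Uc : U k (xget 0 (U k)) by apply: xgetPex; exists x.
  rewrite /r ifF; last by apply/negbTE/set0P; exists x.
  have [fd _] := diam_fin_num Ux (dU k).
  by rewrite -lee_fin fineK//; exact: (le_diam Uc Ux).
- rewrite -lee_fin; apply/ltW/(le_lt_trans _ sumU).
  apply: (@le_trans _ _ (\sum_(0 <= k < n) gauge s' (U k))%E); last first.
    by apply: nneseries_lim_ge => k _ _; exact: gauge_ge0.
  by rewrite -sumEFin big_mkord; apply: lee_sum => k _; have [] := rE k.
Qed.

Lemma hausdorff_dimE {R : realType} (d : R) (A : set R) : 0 <= d ->
  (forall s, d < s -> gauge_null s A) ->
  (forall s, 0 < s < d -> ~ gauge_null s A) ->
  hausdorff_dim (A : set R^o) = d%:E.
Proof.
move=> d0 Hup Hlow; apply/eqP; rewrite eq_le; apply/andP; split.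
  apply/lee_addgt0Pr => e e0; apply: ereal_inf_lbound; exists (d + e) => //.
  by split; [lra | apply: hausdorff_measure_eq0; [lra | apply: Hup; lra]].
apply: le_ereal_inf_tmp => _ [s [s0 Hs] <-]; rewrite lee_fin leNgt.
(* The midpoint is positive even for [s = 0], where [Hlow] is silent. *)
apply/negP => sd; apply: (Hlow ((s + d) / 2)); first by lra.
by apply: (gauge_null_of_hausdorff _ _ Hs); lra.
Qed.

(** The second hypothesis says that [G] is injective on [B] with a [p]-Hoelder inverse, so a cover
    of [A] pulls back. With [p = 1] this handles affine changes of variable, with [p < 1] the coding
    of the Cantor set. *)
Lemma gauge_null_hoelder {R : realType} (p u C : R) (G : R -> R) (A B : set R) :
  0 < p -> 0 < u -> 0 < C -> (forall y, B y -> A (G y)) ->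
  (forall y z, B y -> B z -> `|y - z| <= C * `|G y - G z| `^ p) ->
  gauge_null (p * u) A -> gauge_null u B.
Proof.
move=> p0 u0 C0 BA hG HA eta eta0.
have K0 : 0 < (C * 2 `^ p) `^ u by rewrite powR_gt0// mulr_gt0// powR_gt0.
have [c [r [r0 Ac sumr]]] := HA _ (divr_gt0 eta0 K0).
pose P k := B `&` [set y | `|G y - c k| <= r k].
have r'0 k : 0 <= C * (2 * r k) `^ p by rewrite mulr_ge0 ?powR_ge0// ltW.
(* Each nonempty piece is centered at one of its own points; two points of a piece have images
   within [2 * r k]. *)
exists (fun k => xget 0 (P k)), (fun k => C * (2 * r k) `^ p); split=> // [y By|n].
  have [k yk] := Ac _ (BA _ By); exists k.
  have [Bz zk] : P k (xget 0 (P k)) by apply: xgetPex; exists y.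
  apply: (le_trans (hG _ _ By Bz)); rewrite ler_pM2l//.
  apply: ge0_ler_powR; rewrite ?nnegrE ?mulr_ge0//; first exact: ltW.
  set z := xget _ _ in zk *.
  have -> : G y - G z = (G y - c k) - (G z - c k) by rewrite opprB addrA subrK.
  by rewrite (le_trans (ler_normB _ _))//; move: yk zk => /=; lra.
apply: (@le_trans _ _ ((C * 2 `^ p) `^ u * \sum_(k < n) r k `^ (p * u))); last first.
  by rewrite mulrC -ler_pdivlMr.
rewrite mulr_sumr; apply: ler_sum => k _.
by rewrite (powRM _ _ (r0 k))// mulrA powRM ?powR_ge0 ?mulr_ge0 ?powR_ge0 ?(ltW C0)// powRrM.
Qed.

Lemma gauge_null_subset {R : realType} (s : R) (A B : set R) :
  A `<=` B -> gauge_null s B -> gauge_null s A.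
Proof.
move=> AB HB eta /HB[c [r [r0 Bc sumr]]].
by exists c, r; split=> // x /AB/Bc.
Qed.

Lemma gauge_nullU {R : realType} (s : R) (A B : set R) :
  gauge_null s A -> gauge_null s B -> gauge_null s (A `|` B).
Proof.
move=> HA HB eta eta0; have e20 : 0 < eta / 2 by rewrite divr_gt0.
have [c [r [r0 Ac sumr]]] := HA _ e20.
have [c' [r' [r'0 Bc sumr']]] := HB _ e20.
exists (fun k => if odd k then c k./2 else c' k./2).
exists (fun k => if odd k then r k./2 else r' k./2); split=> [k|x|n].
- by case: ifP.
- case=> [/Ac[k xk]|/Bc[k xk]].
    by exists k.*2.+1; rewrite /= odd_double/= uphalf_double.
  by exists k.*2; rewrite odd_double doubleK.
- pose F k := (if odd k then r k./2 else r' k./2) `^ s.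
  apply: (@le_trans _ _ (\sum_(k < n.*2) F k)).
    rewrite -addnn big_split_ord/= lerDl sumr_ge0// => k _; exact: powR_ge0.
  have -> : \sum_(k < n.*2) F k = \sum_(k < n) r' k `^ s + \sum_(k < n) r k `^ s.
    elim: n => [|n IH]; first by rewrite !big_ord0 addr0.
    rewrite doubleS !big_ord_recr/= IH /F /= odd_double/= uphalf_double doubleK.
    by rewrite -!addrA; congr (_ + _); rewrite addrCA.
  by have := sumr n; have := sumr' n; lra.
Qed.

Lemma gauge_null_range {R : realType} (s : R) (g : nat -> R) :
  0 < s -> gauge_null s (range g).
Proof.
move=> s0 eta eta0; exists g, (fun=> 0); split=> // [x [k _ <-]|n].
  by exists k; rewrite subrr normr0.
by rewrite big1 ?ltW// => k _; rewrite powR0// gt_eqF.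
Qed.

Lemma not_gauge_null_unit {R : realType} : ~ gauge_null (1 : R) [set x | 0 <= x < 1].
Proof.
move=> H; have e0 : 0 < 1 / 4 :> R by [].
have [c [r [r0 Ac sumr]]] := H _ e0.
pose F k : set R := `[c k - r k, c k + r k]%classic.
have muF k : lebesgue_measure (F k) = (2 * r k)%:E.
  rewrite lebesgue_measure_itv/= lte_fin.
  case: ltP => [_|h]; first by rewrite -EFinB; congr EFin; ring.
  have -> : r k = 0 by have := r0 k; lra.
  by rewrite mulr0.
have : (lebesgue_measure (`[0%R, 1%R[%classic : set R) <=
        \sum_(0 <= k <oo) lebesgue_measure (F k))%E.
  apply: measure_sigma_subadditive => [k| |x]; [exact: measurable_itv..|].
  rewrite /= in_itv/= => /Ac[k xk]; exists k => //.
  by move: xk; rewrite /F/= in_itv/= ler_norml; lra.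
rewrite lebesgue_measure_itv/= lte_fin ltr01 oppr0 adde0.
apply/negP; rewrite -ltNge (@le_lt_trans _ _ (1 / 2)%:E)//; last by rewrite lte_fin; lra.
apply: lime_le; first by apply: is_cvg_nneseries.
apply: nearW => n; under eq_bigr do rewrite muF.
rewrite sumEFin lee_fin -mulr_sumr big_mkord.
have := sumr n; under eq_bigr do rewrite powRr1//.
by lra.
Qed.

(** * Heavy sets up to countable sets, and their behaviour under phi *)

Lemma iter_rotationE {R : realType} (theta x : R) (i : nat) : 0 <= x < 1 ->
  0 <= iter i (rotation theta) x < 1 /\
  exists k : int, iter i (rotation theta) x = x + theta * i%:R + k%:~R.
Proof.
move=> hx; elim: i => [|i [_ [k IH]]].
  by split=> //; exists 0; rewrite mulr0 !addr0.
have -> : iter i.+1 (rotation theta) x = rotation theta (iter i (rotation theta) x) by [].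
rewrite IH /rotation; set z := _ + k%:~R + theta; split.
  by have := floor_itv z; rewrite intrD; lra.
by exists (k - Num.floor z); rewrite intrB /z -natr1; ring.
Qed.

Lemma heavy_f_square_wave {R : realType} (z : R) :
  0 <= z < 1 -> z != 1 / 2 -> heavy_f z = square_wave z.
Proof.
move=> /andP[z0 z1] zh; rewrite /heavy_f !indicE !mem_setE !in_itv/= z0 z1 andbT/=.
have [h|h] := lerP z 2^-1.
  rewrite subr0 (@square_waveE _ _ 0) ?expr0z// !intrD.
  by move: zh; rewrite neq_lt => /orP[]; lra.
by rewrite sub0r (@square_waveE _ _ 1) ?expr1z// !intrD; lra.
Qed.

(** The two step functions differ on [0, 1[ only at 1/2, so the exceptional points are those of the
    backward orbit of 1/2. *)
Lemma heavy_setE {R : realType} (theta x : R) :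
  ~ range (fun i : nat => 1 / 2 - theta * i%:R -
                          (Num.floor (1 / 2 - theta * i%:R))%:~R) x ->
  heavy_set theta x <-> wave_heavy theta x.
Proof.
move=> hx; have sumE n : 0 <= x < 1 -> birkhoff_sum theta n x = wave_sum theta x n.
  move=> x01; apply: eq_bigr => i _.
  have [z01 [k zE]] := iter_rotationE theta i x01.
  rewrite heavy_f_square_wave// zE ?square_waveDint//.
  apply/eqP => h; apply: hx; exists (nat_of_ord i) => //.
  have -> : Num.floor (1 / 2 - theta * i%:R) = k by apply: floor_def; rewrite intrD; lra.
  by lra.
split=> -[x01 H]; split=> // n; last by rewrite sumE.
by case: n => [|n]; [rewrite wave_sum0 | rewrite -sumE// H].
Qed.

Lemma gauge_null_heavy_set {R : realType} (s theta : R) : 0 < s ->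
  gauge_null s (heavy_set theta) <-> gauge_null s (wave_heavy theta).
Proof.
move=> s0; pose E : set R := range (fun i : nat => 1 / 2 - theta * i%:R -
  (Num.floor (1 / 2 - theta * i%:R))%:~R).
have nE : gauge_null s E by exact: gauge_null_range.
by split=> /gauge_nullU /(_ nE); apply: gauge_null_subset => x hx;
  have [Ex|/heavy_setE Ex] := pselect (E x); [right|left|right|left] => //; apply/Ex.
Qed.

Lemma square_wave_reflect {R : realType} (z : R) :
  (forall k : int, 2 * z <> k%:~R) -> square_wave (1 / 2 - z) = square_wave z.
Proof.
move=> hz; have := floor_itv (2 * z); set k := Num.floor _ => /andP[].
rewrite le_eqVlt => /predU1P[/esym/hz//|k0 k1].
rewrite (@square_waveE _ _ (- k)); last first.
  by move: k0 k1; rewrite !intrD mulrNz; lra.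
rewrite (@square_waveE _ _ k); last by rewrite ltW.
by rewrite -(signzD2 (- k) k); congr (_ ^ _); lia.
Qed.

(* Up to a countable set, [x |-> 1 / 2 - x] exchanges the heavy sets of [theta]
   and [1 - theta]. *)
Lemma gauge_null_wave_heavy_opp {R : realType} (s t : R) : 0 < s ->
  gauge_null s (wave_heavy (1 / 2 + t)) -> gauge_null s (wave_heavy (1 / 2 - t)).
Proof.
(* [E] contains the points of [0, 1/2[ whose orbit meets a jump of [square_wave], where the
   half-open steps break the reflection. *)
move=> s0 H; pose E : set R := range (fun i : nat =>
  (2 * t * i%:R - (Num.floor (2 * t * i%:R))%:~R) / 2).
have nE : gauge_null s E by exact: gauge_null_range.
suff /gauge_nullU/(_ nE) : gauge_null s (wave_heavy (1 / 2 - t) `\` E).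
  apply: gauge_null_subset => x hx.
  by have [Ex|Ex] := pselect (E x); [right | left].
rewrite -[s]mul1r in H.
apply: (@gauge_null_hoelder _ 1 s 1 (fun x => 1 / 2 - x) _ _ ltr01 s0 ltr01 _ _ H).
  move=> x [hx Ex]; have /andP[x0 x1] := wave_heavy_lt_half hx.
  split=> [|n]; first by lra.
  case: hx => _ /(_ n); congr (_ <= _); apply: eq_bigr => i _.
  rewrite -square_wave_reflect => [|k kE].
    have -> : 1 / 2 - (x + (1 / 2 - t) * i%:R) =
      1 / 2 - x + (1 / 2 + t) * i%:R + (- i%:Z)%:~R by rewrite mulrNz -pmulrn; lra.
    by rewrite square_waveDint.
  apply: Ex; exists (nat_of_ord i) => //.
  have -> : Num.floor (2 * t * i%:R) = i%:Z - k.
    by apply: floor_def; rewrite !intrD mulrNz -kE -pmulrn; lra.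
  by rewrite intrB -kE -pmulrn; lra.
move=> y z _ _; rewrite mul1r powRr1//.
by rewrite -[X in X <= _]normrN opprB le_eqVlt; apply/orP; left; apply/eqP; congr `|_|; ring.
Qed.

Lemma gauge_null_phi_return {R : realType} (s t : R) (m : nat) :
  0 < s -> (0 < m)%N -> - (1 / 2) < t < 1 / 2 ->
  gauge_null s (wave_heavy (1 / 2 + phi m t)) ->
  gauge_null s (wave_heavy (1 / 2 + t)).
Proof.
move=> s0 m0 ht H; have /andP[t0 t1] := ht.
have m1 : 1 <= m%:R :> R by rewrite ler1n.
have k0 : 0 < 2 * (m%:R - t) by lra.
rewrite -[s]mul1r in H.
apply: (@gauge_null_hoelder _ 1 s _ (phi_branch m t 0) _ _ ltr01 s0 k0 _ _ H).
  move=> h /wave_heavyP hh; apply/wave_heavyP => N; apply: (heavy_upto_le (leqnSn N)).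
  exact: (@phi_branch_heavy_upto _ m t h 0).
move=> y z _ _; rewrite powRr1// -{1}(gtr0_norm k0) -normrM.
rewrite le_eqVlt; apply/orP; left; apply/eqP; congr `|_|.
by rewrite /phi_branch; field; rewrite gt_eqF//; lra.
Qed.

Lemma gauge_null_bigU {R : realType} (s : R) (F : nat -> set R) (n : nat) :
  0 < s -> (forall j, gauge_null s (F j)) ->
  gauge_null s [set x | exists2 j, (j < n)%N & F j x].
Proof.
move=> s0 HF; elim: n => [|n IH].
  by apply: gauge_null_subset (gauge_null_range (fun=> 0) s0) => x [].
apply: gauge_null_subset (gauge_nullU IH (HF n)) => x [j].
rewrite ltnS leq_eqVlt => /predU1P[->|jn] Fx; first by right.
by left; exists j.
Qed.

Lemma gauge_null_phi {R : realType} (s t : R) (m : nat) :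
  0 < s -> (0 < m)%N -> - (1 / 2) < t < 1 / 2 ->
  gauge_null s (wave_heavy (1 / 2 + t)) ->
  gauge_null s (wave_heavy (1 / 2 + phi m t)).
Proof.
move=> s0 m0 ht H; have /andP[t0 t1] := ht.
have m1 : 1 <= m%:R :> R by rewrite ler1n.
have k0 : 0 < 2 * (m%:R - t) by lra.
(* [G j] inverts the branch of index [j - 1]; the shift makes room for the branch -1, which occurs
   for negative [t], hence [m.+1] pieces. *)
pose G j (x : R) := 2 * (m%:R - t) * x - (j%:R - 1) - (1 / 2 - t).
have HG j : gauge_null s [set x | wave_heavy (1 / 2 + t) (G j x)].
  rewrite -[s]mul1r in H; have ki0 : 0 < (2 * (m%:R - t))^-1 by rewrite invr_gt0.
  apply: (@gauge_null_hoelder _ 1 s _ (G j) _ _ ltr01 s0 ki0 _ _ H) => // y z _ _.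
  rewrite powRr1// -{1}(gtr0_norm ki0) -normrM.
  rewrite le_eqVlt; apply/orP; left; apply/eqP; congr `|_|.
  by rewrite /G; field; rewrite gt_eqF//; lra.
apply: gauge_null_subset (gauge_null_bigU m.+1 s0 HG) => x hx.
have [h [i [hh /andP[im1 im] _ ->]]] := wave_heavy_phi_branch m0 ht hx.
exists (absz (i + 1)); first by lia.
rewrite /= /G.
have -> : (absz (i + 1))%:R = i%:~R + 1 :> R.
  by rewrite pmulrn gez0_abs ?intrD//; lia.
suff -> : 2 * (m%:R - t) * phi_branch m t i h - (i%:~R + 1 - 1) - (1 / 2 - t) = h by [].
by rewrite /phi_branch; field; rewrite gt_eqF//; lra.
Qed.

(** * Cantor structure and dimension *)

(** Take for [e k] the supremum of the finite compositions of [B k], [B k.+1], ... applied to 0.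
    Monotonicity gives [e k <= B k (e k.+1)], and the Lipschitz bound excludes a strict
    inequality. *)
Lemma backward_orbit {R : realType} (B : nat -> R -> R) (b : R) : 0 <= b ->
  (forall k t t', 0 <= t <= t' -> t' <= b ->
     [/\ 0 <= B k t, B k t <= B k t' <= b & B k t' - B k t <= t' - t]) ->
  exists e : nat -> R, forall k, 0 <= e k <= b /\ e k = B k (e k.+1).
Proof.
move=> b0 HB.
pose a := fix a n k := if n is n'.+1 then B k (a n' k.+1) else 0.
have aP n k : 0 <= a n k <= b.
  elim: n k => [|n IH] k /=; first by rewrite lexx.
  have /andP[h0 h1] := IH k.+1.
  have h : 0 <= a n k.+1 <= a n k.+1 by rewrite h0 lexx.
  by have [-> /andP[_ ->]] := HB k _ _ h h1.
pose S k := range (a ^~ k).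
have Ssup k : has_sup (S k).
  split; first by exists (a 0%N k), 0%N.
  by exists b => _ [n _ <-]; have /andP[] := aP n k.
have a_sup n k : a n k <= sup (S k).
  by apply: sup_upper_bound => //; exists n.
have supP k : 0 <= sup (S k) <= b.
  rewrite (le_trans _ (a_sup 0%N k))//=; apply: ge_sup; first by case: (Ssup k).
  by move=> _ [n _ <-]; have /andP[] := aP n k.
exists (fun k => sup (S k)) => k; split=> //.
have /andP[s0 sb] := supP k.+1.
have aB n : [/\ 0 <= a n.+1 k, a n.+1 k <= B k (sup (S k.+1)) <= b &
    B k (sup (S k.+1)) - a n.+1 k <= sup (S k.+1) - a n k.+1].
  by apply: HB => //; rewrite a_sup andbT; have /andP[] := aP n k.+1.
apply/eqP; rewrite eq_le; apply/andP; split.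
  apply: ge_sup; first by case: (Ssup k).
  move=> _ [[|n] _ <-] /=; last by have [_ /andP[]] := aB n.
  by have [h0 /andP[h1 _] _] := aB 0%N; exact: le_trans h0 h1.
rewrite leNgt; apply/negP => h.
have d0 : 0 < B k (sup (S k.+1)) - sup (S k) by rewrite subr_gt0.
have [_ [n _ <-] hn] := sup_adherent d0 (Ssup k.+1).
have [_ _ h3] := aB n; have := a_sup n.+1 k.
by move: hn h3 => /=; lra.
Qed.

Lemma phi_lipschitz {R : realType} (m : nat) (t t' : R) :
  (0 < m)%N -> t <= t' -> t' <= 1 / 2 -> 0 <= phi m t' - phi m t <= t' - t.
Proof.
move=> m0 tt' t'1; have m1 : 1 <= m%:R :> R by rewrite ler1n.
have -> : phi m t' - phi m t = (t' - t) / (4 * (m%:R - t') * (m%:R - t)).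
  by rewrite /phi; field; rewrite !gt_eqF//; lra.
have h : 1 <= 4 * (m%:R - t') * (m%:R - t) by nra.
apply/andP; split; first by rewrite divr_ge0//; lra.
rewrite ler_pdivrMr; last lra.
by rewrite ler_peMr//; lra.
Qed.

Lemma phi1_iter_lipschitz {R : realType} (n : nat) (t t' : R) :
  t <= t' -> t' <= 1 / 2 -> 0 <= phi1_iter n t' - phi1_iter n t <= t' - t.
Proof.
move=> tt' t'1; have k1 := phi1_denom_ge1 n t'1.
have k2 := phi1_denom_ge1 n (le_trans tt' t'1).
have -> : phi1_iter n t' - phi1_iter n t =
    (t' - t) / ((1 + n%:R * (1 - 2 * t')) * (1 + n%:R * (1 - 2 * t))).
  by rewrite /phi1_iter; field; rewrite !gt_eqF//; lra.
set k := 1 + _ in k1 *; set k' := 1 + _ in k2 *.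
have h : 1 <= k * k' by nra.
apply/andP; split; first by rewrite divr_ge0//; lra.
rewrite ler_pdivrMr; last lra.
by rewrite ler_peMr//; lra.
Qed.

Definition block_orbit {R : realType} (m n : nat -> nat) (e : nat -> R) : Prop :=
  forall k, [/\ (2 <= m k)%N, 0 < e k < 1 / 6 & e k = block (m k) (n k) (e k.+1)].

Lemma exists_block_orbit {R : realType} (m n : nat -> nat) :
  (forall k, (2 <= m k)%N) -> exists e : nat -> R, block_orbit m n e.
Proof.
move=> m2; have b0 : 0 <= 1 / 6 :> R by [].
have [k t t' /andP[t0 tt'] t'b|e He] :=
    @backward_orbit R (fun k => block (m k) (n k)) (1 / 6) b0.
  have ht : 0 <= t < 1 / 2 by lra.
  have ht' : 0 <= t' < 1 / 2 by lra.
  have t'h : t' <= 1 / 2 by lra.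
  have /andP[u0 u1] := phi1_iter_ge0_lt (n k) ht.
  have /andP[v0 v1] := phi1_iter_ge0_lt (n k) ht'.
  have /andP[l0 l1] := phi1_iter_lipschitz (n k) tt' t'h.
  have /andP[b1 b2] := block_gt0_lt (n k) (m2 k) ht.
  have /andP[b3 b4] := block_gt0_lt (n k) (m2 k) ht'.
  have u01 : phi1_iter (n k) t <= phi1_iter (n k) t' by lra.
  have /andP[p0 p1] := phi_lipschitz (ltnW (m2 k)) u01 (ltW v1).
  by rewrite /block in b1 b2 b3 b4 *; split; lra.
exists e => k; have [ek eE] := He k; split=> //.
(* The limit satisfies closed bounds only; one more application of [block] makes them strict. *)
by rewrite {1 2}eE; apply: block_gt0_lt => //; have [] := He k.+1; lra.
Qed.

Lemma block_orbit_shift {R : realType} (m n : nat -> nat) (e : nat -> R) :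
  block_orbit m n e ->
  block_orbit (fun k => m k.+1) (fun k => n k.+1) (fun k => e k.+1).
Proof. by move=> H k; exact: H. Qed.

(** Induction on time, for all levels at once: time [N.+1] at level [k] only needs time [N] at level
    [k.+1]. *)
Lemma wave_heavy_coding {R : realType} (m n : nat -> nat) (e : nat -> R)
    (i : nat -> nat) (x : nat -> R) :
  block_orbit m n e -> (forall k, (i k < m k)%N) -> (forall k, 0 <= x k < 1 / 2) ->
  (forall k, x k = block_branch (m k) (n k) (e k.+1) (i k) (x k.+1)) ->
  wave_heavy (1 / 2 + e 0) (x 0).
Proof.
move=> He im x01 xE; apply/wave_heavyP => N.
suff H k : heavy_upto (1 / 2 + e k) (x k) N by exact: H.
elim: N k => [|N IH] k.
  by split=> // n0; rewrite leqn0 => /eqP ->; rewrite wave_sum0.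
have [m2 _ ->] := He k; rewrite xE; have [_ ek1 _] := He k.+1.
by apply: block_branch_heavy_upto => //; lra.
Qed.

Definition card_level (m : nat -> nat) (k : nat) : nat := \prod_(j < k) m j.

Definition scale_level {R : realType} (m n : nat -> nat) (e : nat -> R) (k : nat) : R :=
  \prod_(j < k) block_ratio (m j) (n j) (e j.+1).

Lemma block_orbit_ratio {R : realType} (m n : nat -> nat) (e : nat -> R) (k : nat) :
  block_orbit m n e ->
  (2 * (m k * (n k).+1)%:R)^-1 <= block_ratio (m k) (n k) (e k.+1)
    <= (m k * (n k).+1)%:R^-1.
Proof. by move=> He; have [m2 _ _] := He k; have [_ ek _] := He k.+1; exact: block_ratio_bounds. Qed.

Lemma block_orbit_ratio_gt0 {R : realType} (m n : nat -> nat) (e : nat -> R) (k : nat) :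
  block_orbit m n e -> 0 < block_ratio (m k) (n k) (e k.+1) <= 1.
Proof.
move=> He; have /andP[h1 h2] := block_orbit_ratio k He; have [m2 _ _] := He k.
have q0 : (0 < m k * (n k).+1)%N by rewrite muln_gt0 (ltnW m2).
rewrite (lt_le_trans _ h1)/=; last by rewrite invr_gt0 mulr_gt0// ltr0n.
by rewrite (le_trans h2)// invf_le1 ?ltr0n// ler1n.
Qed.

Lemma scale_level_gt0 {R : realType} (m n : nat -> nat) (e : nat -> R) (k : nat) :
  block_orbit m n e -> 0 < scale_level m n e k.
Proof. by move=> He; apply: prodr_gt0 => j _; have /andP[] := block_orbit_ratio_gt0 j He. Qed.

Lemma wave_heavy_cover {R : realType} (m n : nat -> nat) (e : nat -> R) (k : nat) :
  block_orbit m n e -> exists c : nat -> R, forall x, wave_heavy (1 / 2 + e 0) x ->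
    exists2 l, (l < card_level m k)%N & `|x - c l| <= scale_level m n e k.
Proof.
elim: k m n e => [|k IH] m n e He.
  exists (fun=> 0) => x /wave_heavy_lt_half hx; exists 0%N.
    by rewrite /card_level big_ord0.
  by rewrite /scale_level big_ord0 subr0 ger0_norm; lra.
have [c Hc] := IH _ _ _ (block_orbit_shift He).
have [m2 _ e0E] := He 0%N; have [_ e1 _] := He 1%N.
have he1 : 0 < e 1%N < 1 / 2 by lra.
pose K := card_level (fun j => m j.+1) k.
exists (fun l => block_branch (m 0) (n 0) (e 1) (l %/ K)%N (c (l %% K)%N)) => x.
rewrite e0E => /wave_heavy_block_branch[||h [i im [hh ->]]]//; first exact: ltnW.
have [l lK hl] := Hc _ hh; exists (i * K + l)%N.
  rewrite /card_level big_ord_recl /= -/(card_level (fun j => m j.+1) k) -/K.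
  by rewrite (@leq_trans (i.+1 * K))// ?leq_mul2r ?im ?orbT// mulSn addnC ltn_add2r.
have K0 : (0 < K)%N by exact: leq_ltn_trans lK.
rewrite divnMDl// (divn_small lK) addn0 modnMDl (modn_small lK).
rewrite block_branchB ?(ltnW m2)// subrr mulr0 add0r normrM.
have /andP[r0 _] := block_orbit_ratio_gt0 0 He.
by rewrite (gtr0_norm r0) /scale_level big_ord_recl /= ler_pM2l.
Qed.

Lemma gauge_null_wave_heavy {R : realType} (m n : nat -> nat) (e : nat -> R) (s : R) :
  0 < s -> block_orbit m n e ->
  (forall eta : R, 0 < eta ->
     exists k, (card_level m k)%:R * scale_level m n e k `^ s <= eta) ->
  gauge_null s (wave_heavy (1 / 2 + e 0)).
Proof.
move=> s0 He small eta /small[k hk]; have [c Hc] := wave_heavy_cover k He.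
have L0 := scale_level_gt0 k He.
exists c, (fun l => if (l < card_level m k)%N then scale_level m n e k else 0).
split=> [l|x /Hc[l lM hl]|N]; first by case: ifP => // _; exact: ltW.
  by exists l; rewrite lM.
apply: le_trans hk; set M := card_level m k; set L := scale_level m n e k.
have -> : \sum_(l < N) (if (l < M)%N then L else 0) `^ s = (minn N M)%:R * L `^ s.
  elim: N => [|N IH]; first by rewrite big_ord0 min0n mul0r.
  rewrite big_ord_recr/= IH; case: ltnP => NM.
    by rewrite (minn_idPl NM) -natr1 mulrDl mul1r.
  by rewrite powR0 ?gt_eqF// addr0 (minn_idPr (leqW NM)).
by rewrite ler_wpM2r ?powR_ge0// ler_nat geq_minr.
Qed.

(** * Mixed-radix coding and the lower bound for the dimension *)

Fixpoint radix_tail {R : realType} (m : nat -> nat) (y : R) (k : nat) : R :=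
  if k is k'.+1 then
    let z := (m k')%:R * radix_tail m y k' in z - (Num.floor z)%:~R
  else y.

Definition radix_digit {R : realType} (m : nat -> nat) (y : R) (k : nat) : nat :=
  absz (Num.floor ((m k)%:R * radix_tail m y k)).

Lemma radix_tail_itv {R : realType} (m : nat -> nat) (y : R) (k : nat) :
  0 <= y < 1 -> 0 <= radix_tail m y k < 1.
Proof.
move=> hy; case: k => [//|k] /=.
by have := floor_itv ((m k)%:R * radix_tail m y k); rewrite intrD; lra.
Qed.

Lemma radix_tailS {R : realType} (m : nat -> nat) (y : R) (k : nat) : 0 <= y < 1 ->
  (m k)%:R * radix_tail m y k = (radix_digit m y k)%:R + radix_tail m y k.+1.
Proof.
move=> hy; have /andP[y0 _] := radix_tail_itv m k hy.
rewrite /radix_digit /= [(absz _)%:R]pmulrn gez0_abs ?floor_ge0 ?mulr_ge0//.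
by rewrite addrC subrK.
Qed.

Lemma radix_digit_lt {R : realType} (m : nat -> nat) (y : R) (k : nat) : (0 < m k)%N ->
  0 <= y < 1 -> (radix_digit m y k < m k)%N.
Proof.
move=> m0 hy; have /andP[_ y1] := radix_tail_itv m k hy.
have /andP[y0 _] := radix_tail_itv m k.+1 hy.
rewrite -(ltr_nat R); have := radix_tailS m k hy.
have : (m k)%:R * radix_tail m y k < (m k)%:R * 1 by rewrite ltr_pM2l ?ltr0n.
by lra.
Qed.

(** The digits of [y] in the bases [m 0], [m 1], ... select the branches, so Lebesgue measure in [y]
    plays the part of a mass distribution. The bound 1/2 is strict because 1/2 is not heavy. *)
Definition codes {R : realType} (m n : nat -> nat) (e : nat -> R) (y : R)
    (x : nat -> R) : Prop :=
  forall k, 0 <= x k < 1 / 2 /\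
    x k = block_branch (m k) (n k) (e k.+1) (radix_digit m y k) (x k.+1).

Lemma block_branch_ge0 {R : realType} (m n : nat) (t : R) (i : nat) (h : R) :
  (0 < m)%N -> 0 < t < 1 / 2 -> 0 <= h -> 0 <= block_branch m n t i h.
Proof.
move=> m0 ht h0; have m1 : 1 <= m%:R :> R by rewrite ler1n.
have /andP[u0 u1] := phi1_iter_itv n ht; have /andP[t0 t1] := ht.
have k1 := phi1_denom_ge1 n (ltW t1).
rewrite /block_branch /phi_branch /phi1_branch -pmulrn.
apply: divr_ge0; last lra; apply: addr_ge0; last lra.
apply: addr_ge0 => //; apply: divr_ge0; last lra.
by rewrite addr_ge0// divr_ge0// mulr_ge0//; lra.
Qed.

Lemma exists_codes {R : realType} (m n : nat -> nat) (e : nat -> R) (y : R) :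
  block_orbit m n e -> 0 <= y < 1 -> exists x, codes m n e y x.
Proof.
move=> He hy; have b0 : 0 <= 1 / 2 :> R by [].
have e01 k : 0 < e k < 1 / 2 by have [_ ek _] := He k; lra.
have m0 k : (0 < m k)%N by have [m2 _ _] := He k; exact: ltnW.
have r01 k := block_orbit_ratio_gt0 k He.
have bE k : 0 < block (m k) (n k) (e k.+1) by have [_ ek <-] := He k; lra.
pose i := radix_digit m y.
have im k : (i k <= (m k).-1)%N by rewrite -ltnS prednK// radix_digit_lt.
have topB k h : h <= 1 / 2 ->
    1 / 2 - block_branch (m k) (n k) (e k.+1) (i k) h =
    2 * block (m k) (n k) (e k.+1) * ((m k).-1%:R - (i k)%:R) +
    block_ratio (m k) (n k) (e k.+1) * (1 / 2 - h).
  by move=> _; rewrite -block_branchB// block_branch_max.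
have [k t t' /andP[t0 tt'] t'b|x Hx] :=
    @backward_orbit R (fun k => block_branch (m k) (n k) (e k.+1) (i k)) (1 / 2) b0.
  have d := block_branchB (n k) (i k) (i k) t' t (m0 k) (e01 k.+1).
  rewrite subrr mulr0 add0r in d; have /andP[r0 r1] := r01 k.
  have b1 : 0 <= 2 * block (m k) (n k) (e k.+1) * ((m k).-1%:R - (i k)%:R).
    by rewrite mulr_ge0// ?subr_ge0 ?ler_nat// ltW// mulr_gt0.
  have d1 : 0 <= block_ratio (m k) (n k) (e k.+1) * (t' - t).
    by rewrite mulr_ge0 ?subr_ge0// ltW.
  have d2 : block_ratio (m k) (n k) (e k.+1) * (t' - t) <= t' - t.
    by rewrite ler_piMl// subr_ge0.
  have d3 : 0 <= block_ratio (m k) (n k) (e k.+1) * (1 / 2 - t').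
    by rewrite mulr_ge0 ?subr_ge0// ltW.
  have := topB k t' t'b; have := block_branch_ge0 (n k) (i k) (m0 k) (e01 k.+1) t0.
  by split; lra.
exists x => k; have [/andP[xk0 xk1] xkE] := Hx k; split=> //; rewrite xk0/= lt_neqAle xk1 andbT.
(* [x k = 1 / 2] forces all the later digits to be maximal, so that the
   distance of the radix tail to [1] at least doubles at every step. *)
apply/eqP => xkh.
have H j : x (k + j)%N = 1 / 2 /\
    2 ^+ j * (1 - radix_tail m y k) <= 1 - radix_tail m y (k + j).
  elim: j => [|j [IHx IHy]]; first by rewrite addn0 expr0; split=> //; rewrite mul1r.
  rewrite addnS; set l := (k + j)%N in IHx IHy *.
  have [_ xlE] := Hx l; have [/andP[_ xl1] _] := Hx l.+1.
  have := topB l _ xl1; rewrite -xlE IHx subrr => E.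
  have /andP[r0 _] := r01 l.
  have b1 : 0 <= 2 * block (m l) (n l) (e l.+1) * ((m l).-1%:R - (i l)%:R).
    by rewrite mulr_ge0// ?subr_ge0 ?ler_nat// ltW// mulr_gt0.
  have b2 : 0 <= block_ratio (m l) (n l) (e l.+1) * (1 / 2 - x l.+1).
    by rewrite mulr_ge0 ?subr_ge0// ltW.
  have rN0 : block_ratio (m l) (n l) (e l.+1) != 0 by rewrite gt_eqF.
  have bN0 : 2 * block (m l) (n l) (e l.+1) != 0 by rewrite gt_eqF// mulr_gt0.
  have /eqP : block_ratio (m l) (n l) (e l.+1) * (1 / 2 - x l.+1) = 0 by lra.
  rewrite mulf_eq0 (negbTE rN0)/= subr_eq0 => /eqP xh.
  have /eqP : 2 * block (m l) (n l) (e l.+1) * ((m l).-1%:R - (i l)%:R) = 0 by lra.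
  rewrite mulf_eq0 (negbTE bN0)/= subr_eq0 => /eqP il.
  split=> //.
  have := radix_tailS m l hy; rewrite -/(i l) -il.
  have -> : (m l).-1%:R = (m l)%:R - 1 :> R by rewrite -subn1 natrB.
  have [m2 _ _] := He l; have m2R : 2 <= (m l)%:R :> R by rewrite ler_nat.
  have /andP[_ y1] := radix_tail_itv m l hy.
  move=> tE; have : 2 * (1 - radix_tail m y l) <= (m l)%:R * (1 - radix_tail m y l).
    by rewrite ler_wpM2r// subr_ge0 ltW.
  rewrite exprS -mulrA => h; apply: (@le_trans _ _ (2 * (1 - radix_tail m y l))).
    by rewrite ler_pM2l.
  by rewrite -[X in _ <= 1 - X]/(radix_tail m y l.+1); lra.
have /andP[_ y1] := radix_tail_itv m k hy.
have d0 : 0 < 1 - radix_tail m y k by rewrite subr_gt0.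
pose j := (Num.truncn (1 - radix_tail m y k)^-1).+1.
have [_] := H j; have /andP[yj0 _] := radix_tail_itv m (k + j) hy.
have : 1 < 2 ^+ j * (1 - radix_tail m y k).
  rewrite -ltr_pdivrMr// div1r; apply: (@lt_trans _ _ j%:R).
    by rewrite /j; apply: truncnS_gt.
  by rewrite -natrX ltr_nat ltn_expl.
by lra.
Qed.

Lemma codes_wave_heavy {R : realType} (m n : nat -> nat) (e : nat -> R) (y : R) x :
  block_orbit m n e -> 0 <= y < 1 -> codes m n e y x -> wave_heavy (1 / 2 + e 0) (x 0).
Proof.
move=> He hy Hx; apply: (wave_heavy_coding (i := radix_digit m y) He) => k.
- by have [m2 _ _] := He k; apply: radix_digit_lt => //; exact: ltnW.
- by have [] := Hx k.
- by have [] := Hx k.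
Qed.

Lemma natr_dist_ge1 {R : realType} (i j : nat) : i != j -> 1 <= `|i%:R - j%:R : R|.
Proof.
rewrite neq_ltn ler_normr => /orP[] lt.
  have : i%:R + 1 <= j%:R :> R by rewrite natr1 ler_nat.
  by lra.
have : j%:R + 1 <= i%:R :> R by rewrite natr1 ler_nat.
by lra.
Qed.

(** The digits move the image by 2 [block] per unit, while [h] and [g] account for at most one
    [block]. Keeping the digit difference in the bound matters: a bare gap 1/(4m) would cost the
    Hoelder estimate a power of [m], and [m] will be unbounded. *)
Lemma block_branch_separated {R : realType} (m n : nat) (t : R) (i j : nat) (h g : R) :
  (0 < m)%N -> 0 < t < 1 / 2 -> i != j -> 0 <= h <= 1 / 2 -> 0 <= g <= 1 / 2 ->
  `|i%:R - j%:R| / (4 * m%:R) <=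
    `|block_branch m n t i h - block_branch m n t j g|.
Proof.
move=> m0 ht ij hh hg; have /andP[t0 t1] := ht.
have D1 := @natr_dist_ge1 R _ _ ij; have b1 := block_ge n m0 ht.
have k1 := phi1_denom_ge1 n (ltW t1).
have b0 : 0 < block m n t.
  by apply: lt_le_trans b1; rewrite invr_gt0 mulr_gt0// ltr0n.
have r0 : 0 <= block_ratio m n t.
  by rewrite /block_ratio divr_ge0//; lra.
have r1 : block_ratio m n t <= 2 * block m n t.
  rewrite /block_ratio ler_pdivrMr; last lra.
  by rewrite ler_peMr//; lra.
rewrite block_branchB//.
have hB := lerB_normD (2 * block m n t * (i%:R - j%:R)) (block_ratio m n t * (h - g)).
apply: le_trans hB.
have b20 : 0 <= 2 * block m n t by lra.
rewrite [`|2 * _ * _|]normrM (ger0_norm b20) normrM (ger0_norm r0).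
set D := `|i%:R - j%:R| in D1 *.
have d1 : `|h - g| <= 1 / 2 by rewrite ler_norml; lra.
have h1 : block_ratio m n t * `|h - g| <= 2 * block m n t * (1 / 2) by rewrite ler_pM.
have h2 : D / (4 * m%:R) <= D * block m n t by rewrite ler_pM2l//; lra.
have h3 : block m n t * 1 <= block m n t * D by rewrite ler_pM2l.
by lra.
Qed.

(* Points whose radix digits first differ at level [k] are coded in different
   cells of level [k + 1], and these are separated by gaps comparable to the
   cells of level [k] divided by [m k]. *)
Lemma codes_hoelder {R : realType} (m n : nat -> nat) (e : nat -> R) (s c : R) y z x w :
  block_orbit m n e -> 0 < s <= 1 -> 0 < c ->
  (forall k, c <= (card_level m k)%:R * scale_level m n e k `^ s) ->
  0 <= y < 1 -> 0 <= z < 1 -> codes m n e y x -> codes m n e z w ->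
  `|y - z| <= 2 / c * 4 `^ s * `|x 0 - w 0| `^ s.
Proof.
move=> He /andP[s0 s1] c0 Hc hy hz Hx Hw.
(* The 2 bounds the difference of the tails relative to that of the digits, the 4 comes from the
   gaps between branches, and [c] from the lower bound on the levels. *)
set K := 2 / c * 4 `^ s.
have K0 : 0 < K by rewrite /K mulr_gt0 ?powR_gt0 ?divr_gt0.
have e01 k : 0 < e k < 1 / 2 by have [_ ek _] := He k; lra.
have m0 k : (0 < m k)%N by have [m2 _ _] := He k; exact: ltnW.
have [//|bound] := leP `|y - z| (K * `|x 0%N - w 0%N| `^ s).
(* If the bound fails, the digits agree at every level, since a first disagreement would prove it;
   then [y = z] because [card_level] is unbounded. *)
have H k : `|y - z| * (card_level m k)%:R = `|radix_tail m y k - radix_tail m z k| /\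
    `|x 0%N - w 0%N| = scale_level m n e k * `|x k - w k|.
  elim: k => [|k [IHy IHx]]; first by rewrite /card_level /scale_level !big_ord0 mulr1 mul1r.
  have [/andP[x0 x1] _] := Hx k.+1; have [/andP[w0 w1] _] := Hw k.+1.
  have [_ xE] := Hx k; have [_ wE] := Hw k.
  have /andP[y0 y1] := radix_tail_itv m k.+1 hy.
  have /andP[z0 z1] := radix_tail_itv m k.+1 hz.
  have yE := radix_tailS m k hy; have zE := radix_tailS m k hz.
  have mk0 : 0 < (m k)%:R :> R by rewrite ltr0n.
  have /andP[r0 r1] := block_orbit_ratio_gt0 k He.
  have L0 := scale_level_gt0 k He.
  have dE : `|radix_tail m y k - radix_tail m z k| * (m k)%:R =
      `|(radix_digit m y k)%:R - (radix_digit m z k)%:R +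
        (radix_tail m y k.+1 - radix_tail m z k.+1)|.
    by rewrite -{1}(gtr0_norm mk0) -normrM; congr `|_|; lra.
  have xwE := block_branchB (n k) (radix_digit m y k) (radix_digit m z k)
    (x k.+1) (w k.+1) (m0 k) (e01 k.+1).
  rewrite -xE -wE in xwE.
  have [dig|dig] := eqVneq (radix_digit m y k) (radix_digit m z k).
    rewrite dig subrr add0r in dE; rewrite dig subrr mulr0 add0r in xwE.
    split; first by rewrite /card_level big_ord_recr/= natrM mulrA IHy.
    rewrite IHx xwE normrM (gtr0_norm r0) mulrA /scale_level.
    by rewrite [in RHS]big_ord_recr.
  exfalso; move: bound; apply/negP; rewrite -leNgt.
  set D := `|(radix_digit m y k)%:R - (radix_digit m z k)%:R : R|.
  have D1 : 1 <= D by exact: natr_dist_ge1.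
  have Dm : D <= (m k)%:R.
    have : (radix_digit m y k)%:R <= (m k)%:R :> R by rewrite ler_nat ltnW// radix_digit_lt.
    have : (radix_digit m z k)%:R <= (m k)%:R :> R by rewrite ler_nat ltnW// radix_digit_lt.
    have : 0 <= (radix_digit m y k)%:R :> R by [].
    have : 0 <= (radix_digit m z k)%:R :> R by [].
    by rewrite /D ler_norml; lra.
  have upper : `|radix_tail m y k - radix_tail m z k| <= 2 * D / (m k)%:R.
    rewrite ler_pdivlMr// dE (le_trans (ler_normD _ _))//.
    have : `|radix_tail m y k.+1 - radix_tail m z k.+1| <= 1 by rewrite ler_norml; lra.
    by rewrite -/D; lra.
  have lower : D / (4 * (m k)%:R) <= `|x k - w k|.
    by rewrite xE wE; apply: block_branch_separated => //; lra.
  set L := scale_level m n e k in IHx L0; set M := card_level m k in IHy.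
  have M0 : 0 < M%:R :> R by rewrite ltr0n prodn_gt0.
  have a0 : 0 < D / (m k)%:R by rewrite divr_gt0//; lra.
  have a1 : D / (m k)%:R <= 1 by rewrite ler_pdivrMr// mul1r.
  have h1 : L * (D / (4 * (m k)%:R)) <= `|x 0%N - w 0%N| by rewrite IHx ler_pM2l.
  have h2 : K * (L * (D / (4 * (m k)%:R))) `^ s <= K * `|x 0%N - w 0%N| `^ s.
    have b0 : 0 <= L * (D / (4 * (m k)%:R)).
      by apply: mulr_ge0; [exact: ltW | apply: divr_ge0; lra].
    by rewrite ler_pM2l//; apply: (ge0_ler_powR (ltW s0)); rewrite ?nnegrE.
  apply: le_trans h2.
  have -> : L * (D / (4 * (m k)%:R)) = L * (D / (m k)%:R) / 4.
    by field; rewrite gt_eqF.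
  have La0 : 0 <= L * (D / (m k)%:R) by rewrite ltW// mulr_gt0.
  rewrite (powRM _ La0)// (powRM _ (ltW L0) (ltW a0)) /K.
  have -> : 2 / c * 4 `^ s * (L `^ s * (D / (m k)%:R) `^ s * 4^-1 `^ s) =
            2 / c * (L `^ s * (D / (m k)%:R) `^ s) * (4 `^ s * 4^-1 `^ s) by ring.
  have -> : 4 `^ s * 4^-1 `^ s = 1 :> R.
    by rewrite -powRM ?invr_ge0// divff ?pnatr_eq0// powR1.
  rewrite mulr1 -(ler_pM2r M0) IHy (le_trans upper)//.
  (* This is where [s <= 1] enters: inside one cell the comparison is between a number in ]0, 1] and
     its power. *)
  have h3 : D / (m k)%:R <= (D / (m k)%:R) `^ s by rewrite ger1_powR// a0.
  have h4 : 0 < (D / (m k)%:R) `^ s by rewrite powR_gt0.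
  have h5 := Hc k; rewrite -/M -/L in h5.
  have -> : 2 / c * (L `^ s * (D / (m k)%:R) `^ s) * M%:R =
    2 * (D / (m k)%:R) `^ s * (M%:R * L `^ s / c) by field; rewrite gt_eqF.
  rewrite -mulrA -[X in X <= _]mulr1; apply: ler_pM => //.
  - by rewrite mulr_ge0// ltW.
  - by rewrite ler_pM2l.
  - by rewrite ler_pdivlMr// mul1r.
have : `|y - z| = 0; last by move=> yz; move: bound; rewrite yz ltNge mulr_ge0 ?powR_ge0// ltW.
apply/eqP; rewrite eq_le normr_ge0 andbT leNgt; apply/negP => d0.
pose k := (Num.truncn `|y - z|^-1).+1.
have [yzE _] := H k.
have : `|radix_tail m y k - radix_tail m z k| < 1.
  have := radix_tail_itv m k hy; have := radix_tail_itv m k hz.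
  by rewrite ltr_norml; lra.
rewrite -yzE mulrC -ltr_pdivlMr// div1r ltNge; apply/negP/negPn/ltW.
apply: (@lt_le_trans _ _ k%:R); first by exact: truncnS_gt.
rewrite ler_nat /card_level; apply: (@leq_trans (2 ^ k)); first by rewrite ltnW// ltn_expl.
rewrite -[X in (2 ^ X)%N]card_ord -prod_nat_const; apply: leq_prod => j _.
by have [] := He j.
Qed.

Lemma not_gauge_null_wave_heavy {R : realType} (m n : nat -> nat) (e : nat -> R) (s c : R) :
  block_orbit m n e -> 0 < s <= 1 -> 0 < c ->
  (forall k, c <= (card_level m k)%:R * scale_level m n e k `^ s) ->
  ~ gauge_null s (wave_heavy (1 / 2 + e 0)).
Proof.
move=> He hs c0 Hc H; apply: (@not_gauge_null_unit R).
have /choice[X HX] : forall y : R, exists x, 0 <= y < 1 -> codes m n e y x.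
  move=> y; have [hy|hy] := pselect (0 <= y < 1); last by exists (fun=> 0).
  by have [x Hx] := exists_codes He hy; exists x.
have /andP[s0 _] := hs.
have K0 : 0 < 2 / c * 4 `^ s by rewrite mulr_gt0 ?powR_gt0 ?divr_gt0.
rewrite -[s]mulr1 in H.
apply: (@gauge_null_hoelder _ s 1 _ (fun y => X y 0%N) _ _ s0 ltr01 K0 _ _ H).
  by move=> y hy; exact: codes_wave_heavy He hy (HX y hy).
move=> y z hy hz; exact: codes_hoelder He hs c0 Hc hy hz (HX y hy) (HX z hz).
Qed.

(** * Choice of the block sizes *)

Lemma card_scale_level {R : realType} (m n : nat -> nat) (e : nat -> R) (s : R) (k : nat) :
  block_orbit m n e ->
  (card_level m k)%:R * scale_level m n e k `^ s =
  \prod_(j < k) ((m j)%:R * block_ratio (m j) (n j) (e j.+1) `^ s).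
Proof.
move=> He; elim: k => [|k IH].
  by rewrite /card_level /scale_level !big_ord0 powR1 mulr1.
rewrite big_ord_recr/= -IH /card_level /scale_level !big_ord_recr/= natrM.
have L0 := scale_level_gt0 k He; have /andP[r0 _] := block_orbit_ratio_gt0 k He.
by rewrite powRM ?ltW//; ring.
Qed.

Lemma prod_small {R : realType} (f : nat -> R) (k0 : nat) :
  (forall j, 0 <= f j) -> (forall j, (k0 <= j)%N -> f j <= 1 / 2) ->
  forall eta : R, 0 < eta -> exists k, \prod_(j < k) f j <= eta.
Proof.
move=> f0 fh eta eta0; set P := \prod_(j < k0) f j.
have P0 : 0 <= P by apply: prodr_ge0.
have H i : \prod_(j < k0 + i) f j <= P / 2 ^+ i.
  elim: i => [|i IH]; first by rewrite addn0 expr0 divr1.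
  rewrite addnS big_ord_recr/= exprSr invfM mulrA.
  rewrite ler_pM ?prodr_ge0//.
  by rewrite -[2^-1]div1r fh// leq_addr.
pose i := (Num.truncn (P / eta)).+1.
exists (k0 + i)%N; apply: le_trans (H i) _.
rewrite ler_pdivrMr ?exprn_gt0// mulrC -ler_pdivrMr//.
apply: (@le_trans _ _ i%:R); first by apply/ltW/truncnS_gt.
by rewrite -natrX ler_nat ltnW// ltn_expl.
Qed.

Lemma prod_lower_bound {R : realType} (f : nat -> R) (k0 : nat) :
  (forall j, 0 < f j) -> (forall j, (k0 <= j)%N -> 1 <= f j) ->
  exists2 c : R, 0 < c & forall k, c <= \prod_(j < k) f j.
Proof.
move=> f0 f1.
have H K : exists2 c : R, 0 < c & forall k, (k <= K)%N -> c <= \prod_(j < k) f j.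
  elim: K => [|K [c c0 Hc]].
    by exists 1 => // k; rewrite leqn0 => /eqP ->; rewrite big_ord0.
  exists (Num.min c (\prod_(j < K.+1) f j)).
    by rewrite lt_min c0 prodr_gt0.
  move=> k; rewrite leq_eqVlt => /predU1P[->|kK]; rewrite ge_min.
    by rewrite lexx orbT.
  by rewrite Hc.
have [c c0 Hc] := H k0; exists c => // k.
have [kk0|k0k] := leqP k k0; first exact: Hc.
rewrite -(subnKC (ltnW k0k)); elim: (k - k0)%N => [|i IH].
  by rewrite addn0; exact: Hc.
rewrite addnS big_ord_recr/= (le_trans IH)// ler_peMr ?f1 ?leq_addr//.
by rewrite prodr_ge0// => j _; exact: ltW.
Qed.

Lemma exists_block_size {R : realType} (d : R) (m : nat) : 0 < d <= 1 -> (0 < m)%N ->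
  exists2 r : nat, (0 < r)%N &
    (m * r)%:R `^ d <= m%:R <= (2 * (m * r)%:R) `^ d.
Proof.
move=> /andP[d0 d1] m0; have m1 : 1 <= m%:R :> R by rewrite ler1n.
have m0R : 0 < m%:R :> R by rewrite ltr0n.
(* The real solution of (m z)^d = m. As [d <= 1] gives [z >= 1], truncating it loses less than a
   factor 2. *)
pose z : R := m%:R `^ (d^-1 - 1).
have z1 : 1 <= z.
  by rewrite /z -[X in X <= _](powRr0 m%:R); apply: ler_powR => //; rewrite subr_ge0 invf_ge1.
have mz : (m%:R * z) `^ d = m%:R.
  rewrite /z mulr_powRB1 ?invr_gt0//.
  by rewrite -powRrM mulVf ?gt_eqF// powRr1.
have /andP[rz zr] : (Num.truncn z)%:R <= z < (Num.truncn z).+1%:R.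
  by apply: truncn_itv; lra.
have r0 : (0 < Num.truncn z)%N.
  by rewrite -ltnS -(ltr_nat R) (le_lt_trans z1).
exists (Num.truncn z) => //; rewrite -{1 2}mz natrM.
have r1 : 1 <= (Num.truncn z)%:R :> R by rewrite ler1n.
rewrite -natr1 in zr.
have mz0 : 0 <= m%:R * z by apply: mulr_ge0; lra.
have mr0 : 0 <= m%:R * (Num.truncn z)%:R :> R by rewrite mulr_ge0.
have rz' : m%:R * (Num.truncn z)%:R <= m%:R * z by rewrite ler_pM2l.
have zr' : m%:R * z <= 2 * (m%:R * (Num.truncn z)%:R).
  by rewrite mulrCA ler_pM2l//; lra.
by apply/andP; split; apply: (ge0_ler_powR (ltW d0)) => //; rewrite nnegrE//; lra.
Qed.

(* The exponents [max d (1 / (k + 1))] are positive and tend to [d] from above,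
   which also covers [d = 0]. *)
Lemma exists_block_sequence {R : realType} (d : R) : 0 <= d <= 1 ->
  exists m n : nat -> nat, forall k, [/\ (2 <= m k)%N, (k <= m k)%N &
    (m k * (n k).+1)%:R `^ (Num.max d k.+1%:R^-1) <= (m k)%:R
      <= (2 * (m k * (n k).+1)%:R) `^ (Num.max d k.+1%:R^-1)].
Proof.
move=> /andP[d0 d1].
have H k : exists r : nat, (k.+2 * r.+1)%:R `^ (Num.max d k.+1%:R^-1) <= k.+2%:R
      <= (2 * (k.+2 * r.+1)%:R) `^ (Num.max d k.+1%:R^-1).
  have hd : 0 < Num.max d k.+1%:R^-1 <= 1.
    by rewrite lt_max invr_gt0 ltr0n orbT/= ge_max d1/= invf_le1// ler1n.
  by have [[//|r] _ Hr] := @exists_block_size _ _ k.+2 hd isT; exists r.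
have [n Hn] := choice H.
by exists (fun k => k.+2), n => k; split=> //; exact: leqW (leqnSn k).
Qed.

Lemma powR_nat_eventually {R : realType} (p b : R) : 0 < p ->
  exists k0 : nat, forall x : R, k0%:R <= x -> b <= x `^ p.
Proof.
move=> p0; pose z := Num.max 0 b `^ p^-1; exists (Num.truncn z).+1 => x hx.
have zx : z <= x by apply: le_trans hx; apply/ltW/truncnS_gt.
have z0 : 0 <= z by exact: powR_ge0.
apply: (@le_trans _ _ (z `^ p)).
  rewrite /z -powRrM mulVf ?gt_eqF// powRr1 ?le_max ?lexx//.
  by rewrite orbT.
by apply: (ge0_ler_powR (ltW p0)); rewrite ?nnegrE// (le_trans z0).
Qed.

(** With q = m (n + 1), the factor of level j is q^(d_j - s) up to constants, where d_j tends to [d]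
    and q >= j. Late factors are therefore at most 1/2 for [s > d] and at least 1 for [s < d]. *)
Lemma exists_block_orbit_dim {R : realType} (d : R) : 0 <= d <= 1 ->
  exists m n : nat -> nat, exists e : nat -> R, [/\ block_orbit m n e,
    (forall s, d < s -> gauge_null s (wave_heavy (1 / 2 + e 0))) &
    (forall s, 0 < s < d -> ~ gauge_null s (wave_heavy (1 / 2 + e 0)))].
Proof.
move=> hd; have /andP[d0 d1] := hd.
have [m [n Hmn]] := exists_block_sequence hd.
have [|e He] := @exists_block_orbit R m n; first by move=> k; have [] := Hmn k.
exists m, n, e; split=> // s.
  move=> ds; have s0 : 0 < s := le_lt_trans d0 ds.
  (* The exponents reach [d] only in the limit, so half of the gap to [s] is given up; past [k2]
     they are at most [d']. In the threshold below, 2^s turns q into 2q and the other 2 yields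
     factors at most 1/2. *)
  pose d' := (s + d) / 2; have d'0 : 0 < d' by rewrite /d'; lra.
  have d's : 0 < s - d' by rewrite /d'; lra.
  have [k1 Hk1] := powR_nat_eventually (2 * 2 `^ s) d's.
  have [k2 Hk2] : exists k2 : nat, forall k, (k2 <= k)%N -> Num.max d k.+1%:R^-1 <= d'.
    exists (Num.truncn d'^-1) => k hk; rewrite ge_max; apply/andP; split.
      by rewrite /d'; lra.
    rewrite -[d']invrK lef_pV2 ?posrE ?invr_gt0 ?ltr0n//.
    by apply/ltW/(lt_le_trans (truncnS_gt _)); rewrite ler_nat.
  apply: (gauge_null_wave_heavy s0 He) => eta eta0.
  have fk0 j : 0 <= (m j)%:R * block_ratio (m j) (n j) (e j.+1) `^ s.
    by rewrite mulr_ge0// powR_ge0.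
  have [|k hk] := prod_small (k0 := maxn k1 k2) fk0 _ eta0; last first.
    by exists k; rewrite card_scale_level.
  move=> j; rewrite geq_max => /andP[j1 j2].
  have [m2 mj /andP[_ hm]] := Hmn j; have /andP[_ rq] := block_orbit_ratio j He.
  have /andP[r0 _] := block_orbit_ratio_gt0 j He.
  set q := (m j * (n j).+1)%N in hm rq.
  have jq : (j <= q)%N by rewrite (leq_trans mj)// leq_pmulr.
  have q1 : (1 <= q)%N by rewrite muln_gt0 (ltnW m2).
  have q1R : 1 <= q%:R :> R by rewrite ler1n.
  have h1 : (m j)%:R <= (2 * q%:R) `^ d'.
    by apply: (le_trans hm); apply: ler_powR; [lra | exact: Hk2].
  have h2 : 2 * 2 `^ s <= (2 * q%:R) `^ (s - d').
    apply: Hk1; apply: (@le_trans _ _ q%:R); last lra.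
    by rewrite ler_nat (leq_trans j1).
  have h3 : block_ratio (m j) (n j) (e j.+1) `^ s <= (q%:R^-1) `^ s.
    by apply: (ge0_ler_powR (ltW s0)); rewrite ?nnegrE ?invr_ge0 ?(ltW r0).
  have twoq : 0 < 2 * q%:R :> R by lra.
  have p0 : 0 < (2 * q%:R) `^ d' by rewrite powR_gt0.
  have p1 : 0 < q%:R `^ s :> R by rewrite powR_gt0//; lra.
  have h4 : (2 * q%:R) `^ (s - d') * (2 * q%:R) `^ d' = 2 `^ s * q%:R `^ s.
    rewrite -powRD; last by apply/implyP => _; rewrite gt_eqF.
    by rewrite subrK powRM//; lra.
  have t0 : 0 < 2 `^ s :> R by rewrite powR_gt0.
  apply: (@le_trans _ _ ((2 * q%:R) `^ d' * q%:R^-1 `^ s)).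
    by apply: ler_pM => //; rewrite ?powR_ge0.
  have -> : q%:R^-1 `^ s = (q%:R `^ s)^-1 :> R.
    by rewrite -powR_inv1 ?ler0n// -powRrM mulN1r powRN.
  rewrite ler_pdivrMr// -(ler_pM2l t0).
  have -> : 2 `^ s * (1 / 2 * q%:R `^ s) = (2 `^ s * q%:R `^ s) / 2 by field.
  rewrite -h4 ler_pdivlMr//.
  by rewrite mulrAC [2 `^ s * 2]mulrC ler_pM2r.
move=> /andP[s0 sd].
have sd0 : 0 < d - s by rewrite subr_gt0.
have [k1 Hk1] := powR_nat_eventually (2 `^ s) sd0.
have fk0 j : 0 < (m j)%:R * block_ratio (m j) (n j) (e j.+1) `^ s.
  have [m2 _ _] := Hmn j; have /andP[r0 _] := block_orbit_ratio_gt0 j He.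
  by rewrite mulr_gt0 ?powR_gt0// ltr0n ltnW.
have [|c c0 Hc] := prod_lower_bound (k0 := k1) fk0; last first.
  apply: (not_gauge_null_wave_heavy He _ c0); first by rewrite s0; lra.
  by move=> k; rewrite card_scale_level.
move=> j j1.
have [m2 mj /andP[hm _]] := Hmn j; have /andP[rq _] := block_orbit_ratio j He.
have /andP[r0 _] := block_orbit_ratio_gt0 j He.
set q := (m j * (n j).+1)%N in hm rq.
have jq : (j <= q)%N by rewrite (leq_trans mj)// leq_pmulr.
have q1 : (1 <= q)%N by rewrite muln_gt0 (ltnW m2).
have q1R : 1 <= q%:R :> R by rewrite ler1n.
have h1 : q%:R `^ d <= (m j)%:R.
  by apply: le_trans hm; apply: ler_powR => //; rewrite le_max lexx.
have h2 : 2 `^ s <= q%:R `^ (d - s).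
  by apply: Hk1; rewrite ler_nat (leq_trans j1).
have h3 : (2 * q%:R)^-1 `^ s <= block_ratio (m j) (n j) (e j.+1) `^ s.
  by apply: (ge0_ler_powR (ltW s0)); rewrite ?nnegrE ?(ltW r0)// invr_ge0; lra.
have q0 : 0 < q%:R :> R by lra.
have p0 : 0 < q%:R `^ s :> R by rewrite powR_gt0.
have h4 : q%:R `^ (d - s) * q%:R `^ s = q%:R `^ d :> R.
  by rewrite -powRD ?subrK//; apply/implyP => _; rewrite gt_eqF.
apply: (@le_trans _ _ (q%:R `^ d * (2 * q%:R)^-1 `^ s)); last first.
  by apply: ler_pM => //; rewrite powR_ge0.
have -> : (2 * q%:R)^-1 `^ s = (2 `^ s * q%:R `^ s)^-1 :> R.
  by rewrite -powRM// -powR_inv1 ?mulr_ge0// -powRrM mulN1r powRN.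
rewrite ler_pdivlMr; last by rewrite mulr_gt0// powR_gt0.
by rewrite mul1r -h4 ler_pM2r.
Qed.

(** * Irrationality and density *)

Lemma phi_inv {R : realType} (m : nat) (t : R) :
  t < m%:R -> t = m%:R - (4 * phi m t)^-1.
Proof. by move=> tm; rewrite /phi; field; rewrite gt_eqF//; lra. Qed.

(** A Euclidean step: inverting a/(2b) and dividing by 4 gives b/(2a), so the shape with denominator
    2b is preserved, and the bound 1/2 on [phi] means a < b. *)
Lemma phi_descent {R : realType} (m : nat) (t : R) (a b : nat) :
  (0 < m)%N -> 0 <= t < 1 / 2 -> (0 < b)%N -> phi m t = a%:R / (2 * b%:R) ->
  (0 < a < b)%N /\ exists a' : nat, t = a'%:R / (2 * a%:R).
Proof.
move=> m0 /andP[t0 t1] b0 phiE; have m1 : 1 <= m%:R :> R by rewrite ler1n.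
have b0R : 0 < b%:R :> R by rewrite ltr0n.
have ht : - (1 / 2) < t < 1 / 2 by lra.
have := phi_gt0_lt_half m0 ht; rewrite phiE => /andP[].
rewrite pmulr_lgt0 ?invr_gt0 ?mulr_gt0// ltr0n => a0.
rewrite ltr_pdivrMr ?mulr_gt0// mulrA divfK ?pnatr_eq0// mul1r ltr_nat => ab.
rewrite a0 ab; split=> //.
have a0R : 0 < a%:R :> R by rewrite ltr0n.
have tm : t < m%:R by lra.
have tE := phi_inv tm; rewrite phiE in tE.
have {}tE : t = (2 * a%:R * m%:R - b%:R) / (2 * a%:R).
  by rewrite [LHS]tE; field; rewrite !gt_eqF.
have le_b : (b <= 2 * a * m)%N.
  rewrite -(ler_nat R) !natrM -subr_ge0.
  by move: t0; rewrite tE pmulr_lge0// invr_gt0 mulr_gt0.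
by exists (2 * a * m - b)%N; rewrite natrB// !natrM.
Qed.

Lemma phi1_iter_descent {R : realType} (n : nat) (t : R) (a b : nat) :
  0 <= t < 1 / 2 -> (0 < b)%N -> phi1_iter n t = a%:R / (2 * b%:R) ->
  exists a' b' : nat, (0 < b' <= b)%N /\ t = a'%:R / (2 * b'%:R).
Proof.
move=> ht; have /andP[_ t1] := ht.
elim: n a b => [|n IH] a b b0.
  by rewrite phi1_iter0 => tE; exists a, b; rewrite b0 leqnn.
rewrite phi1_iterS// => /(phi_descent (ltnSn 0) (phi1_iter_ge0_lt n ht) b0).
move=> [/andP[a0 ab] [a' /(IH _ _ a0)[a'' [b'' [/andP[b''0 b''a] ->]]]]].
by exists a'', b''; rewrite b''0 (leq_trans b''a (ltnW ab)).
Qed.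

(** Infinite descent along the orbit: each block strictly lowers the denominator, so the induction
    on [b] must cover all levels [k]. *)
Lemma block_orbit_irrational {R : realType} (m n : nat -> nat) (e : nat -> R) :
  block_orbit m n e -> irrational (e 0).
Proof.
move=> He.
have H (b : nat) : forall (k a : nat), (0 < b)%N -> e k <> a%:R / (2 * b%:R).
  elim/ltn_ind: b => b IH k a b0; have [m2 _ ->] := He k; have [_ ek _] := He k.+1.
  have ht : 0 <= e k.+1 < 1 / 2 by lra.
  move=> /(phi_descent (ltnW m2) (phi1_iter_ge0_lt (n k) ht) b0).
  move=> [/andP[a0 ab] [a' /(phi1_iter_descent ht a0)]].
  move=> [a'' [b'' [/andP[b''0 b''a]]]].
  exact: IH (leq_ltn_trans b''a ab) _ _ b''0.
move=> /rationalP[z [b e0E]]; have [_ /andP[e0 _] _] := He 0%N.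
have b0 : (0 < b)%N.
  by rewrite lt0n; apply/eqP => b0; move: e0; rewrite e0E b0 invr0 mulr0 ltxx.
case: z e0E => [a|a] e0E.
  apply: (H b 0%N (2 * a)%N b0); rewrite e0E natrM -pmulrn; field.
  by rewrite pnatr_eq0 -lt0n.
move: e0; rewrite e0E NegzE mulrNz mulNr oppr_gt0 ltNge.
by rewrite -pmulrn divr_ge0.
Qed.

Lemma irrational_phi {R : realType} (m : nat) (t : R) :
  t < m%:R -> irrational t -> irrational (phi m t).
Proof.
move=> tm; apply: contra_not => -[q _ qE]; exists (m%:R - (4 * q)^-1) => //.
by rewrite (phi_inv tm) -qE rmorphB/= fmorphV rmorphM/= !ratr_nat.
Qed.

Lemma irrationalN {R : realType} (t : R) : irrational t -> irrational (- t).
Proof.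
by apply: contra_not => -[q _ qE]; exists (- q) => //; rewrite rmorphN/= qE opprK.
Qed.

Lemma irrational_half {R : realType} (t : R) : irrational t -> irrational (1 / 2 + t).
Proof.
apply: contra_not => -[q _ qE]; exists (q - 1 / 2) => //.
by rewrite rmorphB/= qE fmorph_div/= !ratr_nat; ring.
Qed.

(** The dimension is kept as two families of nullity statements because these pass through [phi] and
    the reflection one exponent at a time. *)
Definition good_offset {R : realType} (d t : R) : Prop :=
  [/\ 0 < t < 1 / 2, irrational t,
    forall s, d < s -> gauge_null s (wave_heavy (1 / 2 + t)) &
    forall s, 0 < s < d -> ~ gauge_null s (wave_heavy (1 / 2 + t))].

Lemma exists_good_offset {R : realType} (d : R) :
  0 <= d <= 1 -> exists t, good_offset d t.
Proof.
move=> /exists_block_orbit_dim[m [n [e [He Hup Hlow]]]]; exists (e 0%N); split=> //.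
  by have [_ e0 _] := He 0%N; lra.
exact: block_orbit_irrational He.
Qed.

Lemma good_offset_phi {R : realType} (d t : R) (m : nat) :
  0 <= d -> (0 < m)%N -> good_offset d t -> good_offset d (phi m t).
Proof.
move=> d0 m0 [/andP[t0 t1] it Hup Hlow]; have m1 : 1 <= m%:R :> R by rewrite ler1n.
have ht : - (1 / 2) < t < 1 / 2 by lra.
split=> [|||s /[dup] /andP[s0 _]].
- exact: phi_gt0_lt_half.
- by apply: irrational_phi => //; lra.
- move=> s ds; have s0 : 0 < s := le_lt_trans d0 ds.
  by apply: gauge_null_phi => //; exact: Hup.
- by move=> /Hlow H /(gauge_null_phi_return s0 m0 ht).
Qed.

Lemma good_offset_phiN {R : realType} (d t : R) (m : nat) :
  0 <= d -> (0 < m)%N -> good_offset d t -> good_offset d (phi m (- t)).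
Proof.
move=> d0 m0 [/andP[t0 t1] it Hup Hlow]; have m1 : 1 <= m%:R :> R by rewrite ler1n.
have ht : - (1 / 2) < - t < 1 / 2 by lra.
split=> [|||s /[dup] /andP[s0 _]].
- exact: phi_gt0_lt_half.
- by apply: irrational_phi; [lra | exact: irrationalN].
- move=> s ds; have s0 : 0 < s := le_lt_trans d0 ds.
  by apply: gauge_null_phi => //; apply: gauge_null_wave_heavy_opp => //; exact: Hup.
- move=> /Hlow H /(gauge_null_phi_return s0 m0 ht) /(gauge_null_wave_heavy_opp s0).
  by rewrite opprK.
Qed.

(** The map [phi 1] adds exactly 1 to the reciprocal of 1 - 2t, so its orbits drift to the parabolic
    point 1/2. *)
Lemma good_offset_near_half {R : realType} (d : R) (n : nat) :
  0 <= d <= 1 -> exists2 t, good_offset d t & 1 - 2 * t <= n.+1%:R^-1.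
Proof.
move=> hd; have /andP[d0 _] := hd; elim: n => [|n [t Dt IH]].
  have [t Dt] := exists_good_offset hd; exists t => //.
  by have [/andP[t0 _] _ _ _] := Dt; rewrite invr1; lra.
exists (phi 1 t); first exact: good_offset_phi.
have [/andP[t0 t1] _ _ _] := Dt.
have -> : 1 - 2 * phi 1 t = ((1 - 2 * t)^-1 + 1)^-1.
  by rewrite /phi; field; rewrite !gt_eqF//; lra.
have h : n.+1%:R <= (1 - 2 * t)^-1.
  rewrite -[X in X <= _]invrK lef_pV2 ?posrE ?invr_gt0 ?ltr0n//.
  by lra.
have n0 := ler0n R n.+1; have n2 : n.+2%:R = n.+1%:R + 1 :> R by rewrite natr1.
by rewrite lef_pV2 ?posrE ?ltr0n//; lra.
Qed.

(** A continued fraction with nearest integers: b/(2a) is an integer minus some [v] in [-1/2, 1/2]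
    with denominator 2a, and a < b. Good offsets are positive, so a negative [v] is reached through
    [phi q (- t)]. The error [eta] does not grow since [phi] is 1-Lipschitz. *)
Lemma good_offset_near_rat {R : realType} (d eta : R) (a b : nat) :
  0 <= d <= 1 -> 0 < eta -> (0 < b)%N -> (a <= b)%N ->
  exists2 t, good_offset d t & `|t - a%:R / (2 * b%:R)| < eta.
Proof.
move=> hd eta0; have /andP[d0 _] := hd.
elim/ltn_ind: b a => b IH a b0 ab.
have b0R : 0 < b%:R :> R by rewrite ltr0n.
pose N := Num.truncn eta^-1.
have hN : N.+1%:R^-1 < eta.
  by rewrite -[X in _ < X]invrK ltf_pV2 ?posrE ?ltr0n ?invr_gt0// truncnS_gt.
have [->|a0] := posnP a.
  have [t Dt] := exists_good_offset hd.
  exists (phi N.+1 t); first exact: good_offset_phi.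
  have [/andP[t0 t1] _ _ _] := Dt.
  have h1 : 1 <= N.+1%:R :> R by rewrite ler1n.
  have ht : - (1 / 2) < t < 1 / 2 by lra.
  have /andP[p0 _] := phi_gt0_lt_half (ltn0Sn N) ht.
  rewrite mul0r subr0 gtr0_norm// (le_lt_trans _ hN)//.
  by rewrite /phi lef_pV2 ?posrE; lra.
move: ab; rewrite leq_eqVlt => /predU1P[abE|ab].
  have [t Dt ht] := good_offset_near_half N hd; exists t => //.
  have [/andP[t0 t1] _ _ _] := Dt.
  have -> : a%:R / (2 * b%:R) = 1 / 2 :> R by rewrite abE; field; rewrite gt_eqF.
  by have := le_lt_trans ht hN; rewrite ltr0_norm; lra.
have a0R : 0 < a%:R :> R by rewrite ltr0n.
have lip m (u v : R) : (0 < m)%N -> v = m%:R - b%:R / (2 * a%:R) ->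
    u < 1 / 2 -> v <= 1 / 2 -> `|u - v| < eta -> `|phi m u - a%:R / (2 * b%:R)| < eta.
  move=> m0 vE u1 v1; have m1 : 1 <= m%:R :> R by rewrite ler1n.
  have -> : a%:R / (2 * b%:R) = phi m v.
    have mv : m%:R - v = b%:R / (2 * a%:R) by rewrite vE; ring.
    by rewrite /phi mv; field; rewrite !gt_eqF.
  have [uv|vu] := leP u v; apply: le_lt_trans.
    have /andP[h0 h1] := phi_lipschitz m0 uv v1.
    by rewrite distrC ger0_norm// [X in _ <= X]distrC ger0_norm// subr_ge0.
  have /andP[h0 h1] := phi_lipschitz m0 (ltW vu) (ltW u1).
  by rewrite !ger0_norm// subr_ge0 ltW.
pose q := (b %/ (2 * a))%N; pose r := (b %% (2 * a))%N.
have bE : b = (q * (2 * a) + r)%N by rewrite -divn_eq.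
have ra : (r < 2 * a)%N by rewrite ltn_mod muln_gt0.
have bER : b%:R = q%:R * (2 * a%:R) + r%:R :> R by rewrite {1}bE natrD !natrM.
have [ra'|ar] := leqP r a.
  have q0 : (0 < q)%N.
    rewrite lt0n; apply/eqP => q0; move: ab; rewrite bE q0 mul0n add0n.
    by rewrite ltnNge ra'.
  have [t Dt ht] := IH _ ab _ a0 ra'.
  exists (phi q (- t)); first exact: good_offset_phiN.
  have [/andP[t0 t1] _ _ _] := Dt.
  apply: (@lip _ _ (- (r%:R / (2 * a%:R)))) => //; first by rewrite bER; field; rewrite gt_eqF.
  - by lra.
  - have : 0 <= r%:R / (2 * a%:R) :> R by rewrite divr_ge0// mulr_ge0// ltW.
    by lra.
  - by rewrite -opprD normrN.
have ra'' : (2 * a - r <= a)%N by rewrite leq_subLR mul2n -addnn leq_add2r ltnW.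
have [t Dt ht] := IH _ ab _ a0 ra''.
exists (phi q.+1 t); first exact: good_offset_phi.
have [/andP[t0 t1] _ _ _] := Dt.
apply: (@lip _ _ ((2 * a - r)%:R / (2 * a%:R))) => //.
  by rewrite bER natrB ?(ltnW ra)// natrM -natr1; field; rewrite gt_eqF.
rewrite ler_pdivrMr ?mulr_gt0// mulrA divfK ?pnatr_eq0// mul1r.
by rewrite ler_nat.
Qed.

Lemma hausdorff_dim_heavy_set {R : realType} (d theta : R) : 0 <= d ->
  (forall s, d < s -> gauge_null s (wave_heavy theta)) ->
  (forall s, 0 < s < d -> ~ gauge_null s (wave_heavy theta)) ->
  hausdorff_dim (heavy_set theta : set R^o) = d%:E.
Proof.
move=> d0 Hup Hlow; apply: hausdorff_dimE => // s.
  move=> ds; apply/gauge_null_heavy_set; first exact: le_lt_trans ds.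
  exact: Hup.
move=> /[dup] /Hlow H /andP[s0 _]; apply: contra_not H.
by move=> /(gauge_null_heavy_set theta s0).
Qed.

Lemma hausdorff_dim_heavy_set_near {R : realType} (d x eta : R) :
  0 <= d <= 1 -> 0 < x < 1 -> 0 < eta ->
  exists2 theta : R, [/\ 0 < theta < 1, irrational theta &
    hausdorff_dim (heavy_set theta : set R^o) = d%:E] & `|x - theta| < eta.
Proof.
move=> hd /andP[x0 x1] eta0; have /andP[d0 _] := hd.
pose b := (Num.truncn eta^-1).+1; have b0 : (0 < b)%N by [].
have b0R : 0 < b%:R :> R by rewrite ltr0n.
have hb : b%:R^-1 < eta.
  by rewrite -[X in _ < X]invrK ltf_pV2 ?posrE ?invr_gt0// /b truncnS_gt.
(* By the symmetry about 1/2 only this distance has to be approximated; the side of [x] decides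
   between 1/2 + t and 1/2 - t. *)
pose y : R := `|x - 1 / 2|.
have y0 : 0 <= y by exact: normr_ge0.
have y1 : y < 1 / 2 by rewrite /y ltr_norml; lra.
pose a := Num.truncn (2 * b%:R * y).
have /andP[ay ya] : a%:R <= 2 * b%:R * y < a.+1%:R.
  by apply: truncn_itv; rewrite mulr_ge0// mulr_ge0.
have ab : (a <= b)%N.
  rewrite -(ler_nat R) (le_trans ay)//.
  have : b%:R * y <= b%:R * (1 / 2) by rewrite ler_pM2l// ltW.
  by lra.
have eta20 : 0 < eta / 2 by rewrite divr_gt0.
have [t [/andP[t0 t1] it Hup Hlow] ta] := good_offset_near_rat hd eta20 b0 ab.
have ty : `|t - y| < eta.
  have -> : t - y = (t - a%:R / (2 * b%:R)) - (y - a%:R / (2 * b%:R)) by lra.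
  rewrite (le_lt_trans (ler_normB _ _))// [eta in _ < eta]splitr ltrD//.
  have -> : y - a%:R / (2 * b%:R) = (2 * b%:R * y - a%:R) / (2 * b%:R).
    by field; rewrite gt_eqF.
  have h2b : 0 < 2 * b%:R :> R by lra.
  rewrite ger0_norm ?divr_ge0 ?subr_ge0// ?ltW//.
  rewrite ltr_pdivrMr//; rewrite -natr1 in ya.
  have : 1 < eta * b%:R by rewrite -ltr_pdivrMr// div1r.
  by lra.
have [xh|xh] := leP (1 / 2) x.
  exists (1 / 2 + t).
    split; [lra | exact: irrational_half | exact: hausdorff_dim_heavy_set].
  have yE : y = x - 1 / 2 by rewrite /y ger0_norm// subr_ge0.
  have -> : x - (1 / 2 + t) = - (t - (x - 1 / 2)) by ring.
  by rewrite normrN -yE.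
exists (1 / 2 - t).
  split; [lra | exact: irrational_half (irrationalN it) |].
  apply: hausdorff_dim_heavy_set => // s.
    move=> ds; apply: gauge_null_wave_heavy_opp; first exact: le_lt_trans ds.
    exact: Hup.
  move=> /[dup] /Hlow H /andP[s0 _]; apply: contra_not H.
  by move=> /(gauge_null_wave_heavy_opp s0); rewrite opprK.
have yE : y = - (x - 1 / 2) by rewrite /y ltr0_norm// subr_lt0.
have -> : x - (1 / 2 - t) = t - - (x - 1 / 2) by ring.
by rewrite -yE.
Qed.

Unset Implicit Arguments.

Theorem theorem3 (R : realType) (d : R) (hd : 0 <= d <= 1) :
  `]0, 1[%classic `<=`
  closure [set theta : R |
    [/\ 0 < theta < 1, irrational theta &
        hausdorff_dim (heavy_set theta : set R^o) = d%:E]].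
Proof.
move=> x; rewrite /= in_itv/= => hx B /nbhs_ballP[eta /= eta0 xB].
have [theta Htheta xtheta] := hausdorff_dim_heavy_set_near hd hx eta0.
by exists theta; split=> //; exact: xB.
Qed.
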